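(* Let $A,B,C$ be an additive hypergeometric triple on $\mathbb{C}^m$ with eigenvalue data $a_1,a_2$; $b_1,\dots,b_m$; $-c_1,\dots,-c_m$, normalized eigenvectors $v_i$ of $B$ and $w_i$ of $C$, and operator $S$ as defined in the context, and suppose $a_2=0$. Then the Fuchsian system $$\frac{df}{dz}=\left[\frac{A}{z-1}+\frac{B}{z}\right]f(z),\qquad f:\mathbb{CP}^1\setminus\{0,1,\infty\}\to\mathbb{C}^m,$$ has, for $i=1,\dots,m$, the following Frobenius series solutions in the local parameter $z$ near $0$ and in the local parameter $z^{-1}$ near $\infty$, respectively: $$(T_0)_i=z^{b_i}\left(\sum_{n=0}^{\infty}\alpha_{in}\,e^{Sn}\,z^n\right)v_i,\qquad (T_\infty)_i=z^{c_i}\left(\sum_{n=0}^{\infty}\beta_{in}\,e^{-Sn}\,z^{-n}\right)w_i,$$ where $$\alpha_{in}=\prod_{k=1}^m\frac{\Gamma(b_i-c_k+n)\,\Gamma(b_i-b_k+1)}{\Gamma(b_i-c_k)\,\Gamma(b_i-b_k+n+1)},\qquad \beta_{in}=\prod_{k=1}^m\frac{\Gamma(b_k-c_i+n)\,\Gamma(c_k-c_i+1)}{\Gamma(b_k-c_i)\,\Gamma(c_k-c_i+n+1)}.$$ The series $(T_0)_i$ converge inside the unit circle centered at zero ($|z|<1$), and the series $(T_\infty)_i$ converge inside the unit circle centered at infinity ($|z|>1$).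
   Context: Additive hypergeometric triple: linear operators $A,B,C$ on $\mathbb{C}^m$ such that $A+B+C=0$; $\operatorname{rank}B=\operatorname{rank}C=m$; $A$ is diagonalizable with two different eigenvalues, $a_1$ of multiplicity $1$ and $a_2$ of multiplicity $m-1$; and the operators are generic within these restrictions. The eigenvalues of $B$ are $b_1,\dots,b_m$ with eigenvectors $v_1,\dots,v_m$, and the eigenvalues of $C$ are $-c_1,\dots,-c_m$ with eigenvectors $w_1,\dots,w_m$. Genericity implies that the eigenvalues are generic complex numbers subject to the trace condition $a_1+(m-1)a_2+\sum_{i}(b_i-c_i)=0$ (in particular $b_i-b_j\notin\mathbb{Z}$ and $c_i-c_j\notin\mathbb{Z}$ for $i\ne j$, and $b_i-c_j\notin\mathbb{Z}$ for all $i,j$), and that, if $u$ is an eigenvector of $A$ for $a_1$, there is a unique scaling of the eigenvectors with $\sum_i v_i=\sum_i w_i=u$; this scaling is fixed. Let $V$ be the operator sending the $i$-th standard basis vector to $v_i$, let $X$ be the $m\times m$ matrix with $X_{ij}=\frac{1}{b_j-b_i}$ for $i\neq j$ and $X_{ii}=-\sum_{j\ne i}\frac{1}{b_j-b_i}$, and put $S=VXV^{-1}$. *)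

(* Defs.v *)
From HB Require Import structures.
From mathcomp Require Import all_boot all_order all_algebra.
From mathcomp Require Import all_classical all_reals all_analysis.
From mathcomp Require Import complex.

Set Implicit Arguments.
Unset Strict Implicit.
Unset Printing Implicit Defensive.

Import Order.TTheory GRing.Theory Num.Theory.
Import numFieldNormedType.Exports.

Local Open Scope classical_set_scope.
Local Open Scope ring_scope.
Local Open Scope complex_scope.

(* R[i] itself carries no topology in the library; every numClosedFieldType
   does, so the complex numbers are used under this name. *)
Definition Cplx (R : realType) : numClosedFieldType := R[i].
Arguments Cplx R : simpl never.

Section ComplexFunctions.
Variable R : realType.
Implicit Types z : Cplx R.

Definition cexp z : Cplx R :=
  (expR (complex.Re z))%:C * (cos (complex.Im z) +i* sin (complex.Im z)).

(* Gauss's formula: Gamma(z) = lim n! n^z / (z (z + 1) ... (z + n)), with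
   n^z = exp (z ln n); the value at the poles 0, -1, -2, ... is irrelevant. *)
Definition Gamma z : Cplx R :=
  limn (fun n : nat =>
    n`!%:R * cexp (z * (ln n%:R : R)%:C) / \prod_(k < n.+1) (z + k%:R)).

(* A (possibly local) branch L of log on U; the multivalued power z^s is then
   represented on U by cexp (s * L z). *)
Definition log_branch (U : set (Cplx R)) (L : Cplx R -> Cplx R) : Prop :=
  [/\ open U,
      forall z, U z -> {for z, continuous L}
    & forall z, U z -> cexp (L z) = z].

Definition not_int z : Prop := forall k : int, z != k%:~R.

End ComplexFunctions.

Definition mxexp (R : realType) (m : nat) (M : 'M[Cplx R]_m) : 'M[Cplx R]_m :=
  limn (series (fun k : nat => (k`!%:R : Cplx R)^-1 *: M ^+ k)).

Section Hypergeometric.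
Variables (R : realType) (m : nat).
Implicit Types (A B C S : 'M[Cplx R]_m) (a b c : 'I_m -> Cplx R).
Implicit Types (u : 'cV[Cplx R]_m) (v w : 'I_m -> 'cV[Cplx R]_m).

(* Operators act on column vectors. "Generic" is rendered by the
   non-resonance conditions on the eigenvalues. They make each v i (resp. w i)
   span an eigenline and give u a nonzero component on each of these lines, so
   that the two last conditions only fix the scaling of the eigenvectors. *)
Record additive_hypergeometric_triple A B C (a1 a2 : Cplx R) b c u v w : Prop :=
  AdditiveHypergeometricTriple {
    aht_dim : (1 < m)%N;
    aht_sum : A + B + C = 0;
    aht_rankB : \rank B = m;
    aht_rankC : \rank C = m;
    aht_diagA : diagonalizable A;
    aht_neq : a1 != a2;
    aht_specA : char_poly A = ('X - a1%:P) * ('X - a2%:P) ^+ m.-1;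
    aht_eigu : u != 0 /\ A *m u = a1 *: u;
    aht_eigv : forall i, v i != 0 /\ B *m v i = b i *: v i;
    aht_eigw : forall i, w i != 0 /\ C *m w i = - c i *: w i;
    aht_bb : forall i j, i != j -> not_int (b i - b j);
    aht_cc : forall i j, i != j -> not_int (c i - c j);
    aht_bc : forall i j, not_int (b i - c j);
    aht_sumv : \sum_i v i = u;
    aht_sumw : \sum_i w i = u
  }.

Definition Vmx v : 'M[Cplx R]_m := \matrix_(i, j) v j i 0.

Definition Xmx b : 'M[Cplx R]_m :=
  \matrix_(i, j) if i == j then - \sum_(k | k != i) (b k - b i)^-1
                 else (b j - b i)^-1.

Definition Smx b v : 'M[Cplx R]_m := Vmx v *m Xmx b *m invmx (Vmx v).

Definition alpha b c (i : 'I_m) (n : nat) : Cplx R :=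
  \prod_(k < m) ((Gamma (b i - c k + n%:R) * Gamma (b i - b k + 1)) /
                 (Gamma (b i - c k) * Gamma (b i - b k + n%:R + 1))).

Definition beta b c (i : 'I_m) (n : nat) : Cplx R :=
  \prod_(k < m) ((Gamma (b k - c i + n%:R) * Gamma (c k - c i + 1)) /
                 (Gamma (b k - c i) * Gamma (c k - c i + n%:R + 1))).

Definition T0_series b c S (i : 'I_m) (z : Cplx R) : nat -> 'M[Cplx R]_m :=
  series (fun n : nat => (alpha b c i n * z ^+ n) *: mxexp (n%:R *: S)).

Definition Tinf_series b c S (i : 'I_m) (z : Cplx R) : nat -> 'M[Cplx R]_m :=
  series (fun n : nat => (beta b c i n * z ^- n) *: mxexp (- (n%:R *: S))).

Definition T0 b c S v (L : Cplx R -> Cplx R) (i : 'I_m) (z : Cplx R) :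
    'cV[Cplx R]_m :=
  cexp (b i * L z) *: (limn (T0_series b c S i z) *m v i).

Definition Tinf b c S w (L : Cplx R -> Cplx R) (i : 'I_m) (z : Cplx R) :
    'cV[Cplx R]_m :=
  cexp (c i * L z) *: (limn (Tinf_series b c S i z) *m w i).

Definition fuchsian_solution A B (U : set (Cplx R))
    (f : Cplx R -> 'cV[Cplx R]_m) : Prop :=
  forall z : Cplx R, U z ->
    is_derive z 1 f (((z - 1)^-1 *: A + z^-1 *: B) *m f z).

End Hypergeometric.

(* Main.v *)
(* Put P(x) = prod_l (x - b_l), Q(x) = prod_l (x - c_l) and
     g(x) = sum_k (prod_(l <> k) (x - b_l)) v_k,
   so that (x - B) g(x) = P(x) u.  Since a_2 = 0, A = -(B + C) has rank one with
   image spanned by u, whence (x + C) g(x) = Q(x) u as well, and by symmetry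
   g(x) = sum_k (prod_(l <> k) (x - c_l)) w_k.  The operator S satisfies
   S g = g': it is nilpotent and exp(n S) g(x) = g(x + n) by Taylor's formula.
   As v_i is proportional to g(b_i), the coefficients
   f_n = alpha_in exp(n S) v_i are multiples of g(b_i + n), and the functional
   equation of Gamma turns the two identities above into the recurrence
     (b_i + n + 1 - B) f_(n+1) = (b_i + n + C) f_n,  (b_i - B) f_0 = 0,
   which is the Fuchsian system read off coefficientwise.  The expansion at
   infinity is the one at 0 of the triple (A, C, B) in the variable 1/z. *)

Require Import Defs.
From mathcomp Require Import all_boot all_order all_algebra.
From mathcomp Require Import all_classical all_reals all_analysis.
From mathcomp Require Import complex.
From mathcomp Require Import ring lra.
Set Implicit Arguments.
Unset Strict Implicit.
Unset Printing Implicit Defensive.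
Import Order.TTheory GRing.Theory Num.Theory.
Import numFieldNormedType.Exports.
Local Open Scope classical_set_scope.
Local Open Scope ring_scope.

(** * Products of linear factors over a family of nodes, and the same products with one factor
    removed *)

Section NodePolynomials.
Variables (F : fieldType) (m : nat).
Implicit Types b : 'I_m -> F.

(** Why [S] differentiates: the coordinates of g in the basis [v] are the polynomials p_k(x) =
    prod_(l <> k) (x - b_l), a basis of the polynomials of degree less than m, and row k of [Xmx b]
    lists the coordinates of p_k' in this basis. The nilpotency of [S] is that of d/dx. It makes
    exp(nS) polynomial in n, so convergence is governed by [alpha], whose consecutive ratio tends to
    1. Rank one of B + C only says that (x + C) g(x) is some multiple of u. That the multiple is
    Q(x) comes from the common normalization sum v_i = sum w_i = u, which fixes the leading
    coefficients of g in the basis [w]. The resulting symmetry between (b, v) and (c, w) also shows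
    that both pairs define the same operator [S], which is what lets infinity be treated like 0. Of
    Gamma only the functional equation away from the poles is used. *)

Definition nodal b : {poly F} := \prod_l ('X - (b l)%:P).
Definition conodal b (k : 'I_m) : {poly F} := \prod_(l | l != k) ('X - (b l)%:P).
Definition conodal_col b (x : F) : 'cV[F]_m := \col_k (conodal b k).[x].

Lemma mul_conodal b k : ('X - (b k)%:P) * conodal b k = nodal b.
Proof. by rewrite /nodal (bigD1 k). Qed.

Lemma monic_conodal b k : conodal b k \is monic.
Proof. by apply: monic_prod => l _; rewrite monicXsubC. Qed.

Lemma size_conodal b k : size (conodal b k) = m.
Proof.
have : size (nodal b) = m.+1.
  by rewrite /nodal size_prod_XsubC /index_enum -enumT size_enum_ord.
by rewrite -(mul_conodal b k) size_monicM ?monicXsubC ?monic_neq0 ?monic_conodal //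
  size_XsubC add2n => -[].
Qed.

Lemma horner_nodal b x : (nodal b).[x] = \prod_l (x - b l).
Proof. by rewrite horner_prod; apply: eq_bigr => l _; rewrite hornerXsubC. Qed.

Lemma horner_conodal b k x : (conodal b k).[x] = \prod_(l | l != k) (x - b l).
Proof. by rewrite horner_prod; apply: eq_bigr => l _; rewrite hornerXsubC. Qed.

Lemma conodal_node b k j : j != k -> (conodal b k).[b j] = 0.
Proof. by move=> jk; rewrite horner_conodal (bigD1 j) //= subrr mul0r. Qed.

Lemma conodal_neq0 b k : injective b -> (conodal b k).[b k] != 0.
Proof.
move=> bI; rewrite horner_conodal; apply/prodf_neq0 => l lk.
by rewrite subr_eq0; apply: contra_neq lk => /bI.
Qed.

Lemma eq_poly_nodes b (p q : {poly F}) : injective b ->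
  (size p <= m)%N -> (size q <= m)%N ->
  (forall j, p.[b j] = q.[b j]) -> p = q.
Proof.
move=> bI sp sq pq; apply/subr0_eq.
apply: (@roots_geq_poly_eq0 _ _ (codom b)).
- by apply/allP => z /codomP[j ->]; rewrite rootE hornerD hornerN pq subrr.
- by rewrite map_inj_uniq // enum_uniq.
- rewrite size_codom card_ord (leq_trans (size_polyD _ _)) // size_polyN.
  by rewrite geq_max sp.
Qed.

(** Differentiating [mul_conodal] gives the derivative of [nodal b] whatever the index; the formula
    compares the indices [i] and [j] at the node [b j]. *)
Lemma deriv_conodal_neq b i j : injective b -> i != j ->
  (conodal b i)^`().[b j] = (b j - b i)^-1 * (conodal b j).[b j].
Proof.
move=> bI ij.
have e k : (conodal b k + ('X - (b k)%:P) * (conodal b k)^`()) = (nodal b)^`().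
  by rewrite -(mul_conodal b k) derivM derivXsubC mul1r.
have := congr1 (horner^~ (b j)) (e i); rewrite -(e j) !hornerE.
rewrite conodal_node 1?eq_sym // subrr mul0r addr0 add0r => <-.
rewrite mulKf // subr_eq0; apply: contra_neq ij => /bI //.
Qed.

(** Logarithmic derivative, by induction on the list of factors; none of the factors kept vanishes
    at [b i], by injectivity. *)
Lemma deriv_conodal_eq b i : injective b ->
  (conodal b i)^`().[b i] =
    (\sum_(k | k != i) (b i - b k)^-1) * (conodal b i).[b i].
Proof.
move=> bI; rewrite /conodal.
elim: (index_enum _) => [|k s IHs]; first by rewrite !big_nil mul0r derivC horner0.
rewrite !big_cons; case: eqP => //= /eqP ki.
rewrite derivM derivXsubC mul1r hornerD !hornerM hornerXsubC IHs [RHS]mulrDl; congr (_ + _).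
  by rewrite mulKf // subr_eq0; apply: contra_neq ki => /bI.
by rewrite mulrCA.
Qed.

Lemma sum_conodal_top b (t : 'I_m -> F) :
  (\sum_l t l *: conodal b l)`_m.-1 = \sum_l t l.
Proof.
rewrite coef_sum; apply: eq_bigr => l _; rewrite coefZ.
by have /monicP := monic_conodal b l; rewrite lead_coefE size_conodal => ->; rewrite mulr1.
Qed.

(** The m - 1 prescribed roots determine [p] up to a scalar, and the top coefficient fixes the
    scalar: in the difference the terms of degree m - 1 cancel, leaving too low a degree for so many
    roots. *)
Lemma conodal_char b k (p : {poly F}) : injective b ->
  (size p <= m)%N -> p`_m.-1 = 1 -> (forall j, j != k -> p.[b j] = 0) ->
  p = conodal b k.
Proof.
move=> bI sp tp pj; apply/subr0_eq.
apply: (@roots_geq_poly_eq0 _ _ [seq b j | j <- enum (predC1 k)]).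
- apply/allP => z /mapP[j]; rewrite mem_enum => jk ->.
  by rewrite rootE hornerD hornerN pj // conodal_node // subrr.
- by rewrite map_inj_uniq // enum_uniq.
- rewrite size_map -cardE cardC1 card_ord; apply/leq_sizeP => j.
  rewrite leq_eqVlt coefB => /predU1P[<-|jm].
    rewrite tp; have /monicP := monic_conodal b k.
    by rewrite lead_coefE size_conodal => ->; rewrite subrr.
  have mj : (m <= j)%N by case: (m) jm.
  by rewrite !nth_default ?subrr // ?size_conodal // (leq_trans sp).
Qed.

End NodePolynomials.

(** * Eigenvectors as a basis, and the vector g(x) = [cols v *m conodal_col b x] *)

Section Eigenbasis.
Variables (F : fieldType) (m : nat).
Implicit Types (b : 'I_m -> F) (M : 'M[F]_m) (v : 'I_m -> 'cV[F]_m).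

(** Convertible with [Vmx], but over any field, so that the linear algebra is independent of the
    complex numbers. *)
Definition cols v : 'M[F]_m := \matrix_(i, j) v j i 0.

Lemma cols_mul v (y : 'cV[F]_m) : cols v *m y = \sum_k y k 0 *: v k.
Proof.
apply/matrixP => i j; rewrite !mxE summxE ord1; apply: eq_bigr => k _.
by rewrite !mxE mulrC.
Qed.

Lemma cols_delta v j : cols v *m delta_mx j 0 = v j.
Proof.
rewrite cols_mul (bigD1 j) //= big1 => [|k kj]; last by rewrite mxE (negPf kj) scale0r.
by rewrite mxE !eqxx scale1r addr0.
Qed.

(* A relation sum_k y_k v_k = 0 is preserved by M, so sum_k y_k p(b_k) v_k = 0
   for every polynomial p; p = conodal b j isolates y_j. *)
Lemma eigen_cols_unit M b v : injective b ->
  (forall i, v i != 0 /\ M *m v i = b i *: v i) -> cols v \in unitmx.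
Proof.
move=> bI ev; rewrite -unitmx_tr -row_free_unit; apply: inj_row_free => y0 y0V.
pose y := y0^T.
have yV : \sum_k y k 0 *: v k = 0.
  by rewrite -cols_mul -[LHS]trmxK trmx_mul trmxK y0V trmx0.
have yn n : \sum_k (b k ^+ n * y k 0) *: v k = 0.
  elim: n => [|n IHn]; first by under eq_bigr do rewrite expr0 mul1r.
  have := congr1 (mulmx M) IHn; rewrite mulmx0 mulmx_sumr => {}IHn.
  rewrite -[RHS]IHn; apply: eq_bigr => k _; rewrite -scalemxAr (ev k).2 scalerA exprSr.
  by rewrite mulrAC.
have yp (p : {poly F}) : \sum_k (p.[b k] * y k 0) *: v k = 0.
  under eq_bigr do rewrite horner_coef mulr_suml scaler_suml.
  rewrite exchange_big big1 //= => n _.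
  under eq_bigr do rewrite -mulrA -scalerA.
  by rewrite -scaler_sumr yn scaler0.
apply: (can_inj (@trmxK _ _ _)); rewrite -/y trmx0; apply/colP => j; rewrite [RHS]mxE.
have := yp (conodal b j).
rewrite (bigD1 j) //= big1 => [|k kj]; last by rewrite conodal_node // mul0r scale0r.
rewrite addr0 => /eqP; rewrite scaler_eq0 (negPf (ev j).1) orbF mulf_eq0.
by rewrite (negPf (conodal_neq0 _ bI)) => /eqP.
Qed.

Lemma mul_eigen_cols M b v : (forall i, M *m v i = b i *: v i) ->
  M *m cols v = cols v *m diag_mx (\row_i b i).
Proof.
move=> ev; apply/matrixP => i j; rewrite mul_mx_diag !mxE.
have /(congr1 (fun x : 'cV_m => x i 0)) := ev j; rewrite !mxE => ev'.
by rewrite mulrC -ev'; apply: eq_bigr => k _; rewrite !mxE.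
Qed.

(** In the eigenbasis, x - M multiplies the k-th coordinate by x - b_k, which completes each
    [conodal b k] to the same [nodal b]. The vector g(x) is the resolvent of [M] at the sum of the
    [v k], cleared of denominators. *)
Lemma sub_eigen_conodal M b v x : (forall i, M *m v i = b i *: v i) ->
  (x%:M - M) *m (cols v *m conodal_col b x) =
    (nodal b).[x] *: \sum_k v k.
Proof.
move=> ev; rewrite cols_mul mulmx_sumr scaler_sumr; apply: eq_bigr => k _.
rewrite -scalemxAr mulmxBl mul_scalar_mx ev -scalerBl scalerA mxE.
by rewrite -(mul_conodal b k) hornerM hornerXsubC mulrC.
Qed.

Lemma conodal_col_node b j : conodal_col b (b j) = (conodal b j).[b j] *: delta_mx j 0.
Proof.
apply/colP => k; rewrite !mxE eqxx andbT; case: eqP => [->|/eqP kj].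
  by rewrite mulr1.
by rewrite conodal_node 1?eq_sym // mulr0.
Qed.

Lemma cols_conodal_node b v j :
  cols v *m conodal_col b (b j) = (conodal b j).[b j] *: v j.
Proof. by rewrite conodal_col_node -scalemxAr cols_delta. Qed.

(** At a node the conodal column is a nonzero multiple of a standard basis vector, so the nodes
    suffice to test a matrix identity. *)
Lemma eq_mx_nodes n b (M N : 'M[F]_(n, m)) : injective b ->
  (forall j, M *m conodal_col b (b j) = N *m conodal_col b (b j)) -> M = N.
Proof.
move=> bI MN; apply/matrixP => i j; have := MN j.
rewrite conodal_col_node -!scalemxAr => /(scalerI (conodal_neq0 j bI)).
by move=> /(congr1 (fun x : 'cV_n => x i 0)); rewrite -!colE !mxE.
Qed.

End Eigenbasis.

(** * Symmetry of g between the two eigenbases, from the rank one of B + C *)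

Section HypergeometricPencil.
Variables (F : fieldType) (m : nat) (B C : 'M[F]_m) (b c : 'I_m -> F).
Variables (v w : 'I_m -> 'cV[F]_m) (u : 'cV[F]_m).
Hypotheses (bI : injective b) (cI : injective c).
Hypothesis ev : forall i, v i != 0 /\ B *m v i = b i *: v i.
Hypothesis ew : forall i, w i != 0 /\ C *m w i = - c i *: w i.
Hypotheses (sv : \sum_i v i = u) (sw : \sum_i w i = u).
Hypothesis rk1 : forall y : 'cV_m, exists s, (B + C) *m y = s *: u.

Let ev2 i : B *m v i = b i *: v i. Proof. exact: (ev i).2. Qed.
Let ew2 i : C *m w i = - c i *: w i. Proof. exact: (ew i).2. Qed.
Let NcI : injective (fun i => - c i). Proof. by move=> i j /oppr_inj /cI. Qed.
Let unitW : cols w \in unitmx. Proof. exact: (eigen_cols_unit NcI ew). Qed.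
Let T := invmx (cols w) *m cols v.

(* In the basis w the vector (x + C) g(x) = (x - B) g(x) + (B + C) g(x) is a
   scalar multiple Q(x) of u = (1, ..., 1), hence the k-th coordinate h_k of
   g satisfies (x - c_k) h_k(x) = Q(x). *)
Lemma transition_conodal k :
  \sum_l T k l *: conodal b l = conodal c k.
Proof.
have uE : invmx (cols w) *m u = const_mx 1.
  have <- : cols w *m const_mx 1 = u.
    by rewrite cols_mul -sw; apply: eq_bigr => j _; rewrite mxE scale1r.
  by rewrite mulKmx.
have hE x i : (\sum_l T i l *: conodal b l).[x] = (T *m conodal_col b x) i 0.
  rewrite mxE horner_sum; apply: eq_bigr => l _; by rewrite hornerZ !mxE.
have hQ x : exists q, forall i, (x - c i) * (\sum_l T i l *: conodal b l).[x] = q.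
  have [s hs] := rk1 (cols v *m conodal_col b x).
  exists ((nodal b).[x] + s) => i.
  have := sub_eigen_conodal x ev2.
  rewrite sv => /(congr1 (fun y => y + s *: u)); rewrite -{1}hs -mulmxDl -scalerDl.
  rewrite addrA subrK => /(congr1 (mulmx (invmx (cols w)))).
  have CE : invmx (cols w) *m C = diag_mx (\row_j - c j) *m invmx (cols w).
    by apply: (canRL (mulmxK unitW)); rewrite -mulmxA (mul_eigen_cols ew2) mulKmx.
  rewrite -scalemxAr uE (mulmxA (invmx _)) mulmxDr CE mul_mx_scalar mulmxDl.
  rewrite -scalemxAl -(mulmxA (diag_mx _)) (mulmxA (invmx _)) -/T.
  move=> /(congr1 (fun y : 'cV_m => y i 0)).
  by rewrite hE mul_diag_mx !mxE mulr1 mulrBl mulNr.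
apply: conodal_char => //.
- apply: (leq_trans (size_sum _ _ _)); apply/bigmax_leqP => l _.
  by rewrite (leq_trans (size_scale_leq _ _)) // size_conodal.
(* The top coefficient of the k-th coordinate is that of sum v_l = u in the basis [w], which is 1
   because sum w_l = u as well. *)
- rewrite sum_conodal_top.
  have <- : (T *m (const_mx 1 : 'cV_m)) k 0 = \sum_l T k l.
    by rewrite mxE; apply: eq_bigr => l _; rewrite [const_mx _ _ _]mxE mulr1.
  rewrite /T -mulmxA cols_mul.
  under eq_bigr do rewrite mxE scale1r.
  by rewrite sv uE mxE.
(* At x = c_j the common value [q] vanishes, by its expression through the coordinate [j], while c_j
   - c_k does not. *)
- move=> j jk; have [q hq] := hQ (c j).
  have := hq k; rewrite -(hq j) subrr mul0r => /eqP.
  rewrite mulf_eq0 subr_eq0 => /predU1P[/cI jk'|/eqP //].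
  by rewrite jk' eqxx in jk.
Qed.

Lemma cols_conodal_eq x : cols v *m conodal_col b x = cols w *m conodal_col c x.
Proof.
have -> : conodal_col c x = T *m conodal_col b x.
  apply/colP => k; rewrite mxE -transition_conodal horner_sum mxE.
  by apply: eq_bigr => l _; rewrite hornerZ [conodal_col _ _ _ _]mxE.
by rewrite mulmxA mulKVmx.
Qed.

(** Once g is written in the basis [w], this is [sub_eigen_conodal] for [- C], whose eigenvalues are
    the [c i]. *)
Lemma add_eigen_conodal x :
  (x%:M + C) *m (cols v *m conodal_col b x) = (nodal c).[x] *: u.
Proof.
rewrite cols_conodal_eq -[C]opprK -sw; apply: sub_eigen_conodal => i.
by rewrite mulNmx ew2 -scaleNr opprK.
Qed.

Lemma transition_deriv_conodal x :
  T *m (\col_k (conodal b k)^`().[x]) = \col_k (conodal c k)^`().[x].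
Proof.
apply/colP => k; rewrite [RHS]mxE -transition_conodal raddf_sum horner_sum mxE.
by apply: eq_bigr => l _; rewrite /= derivZ hornerZ [(\col__ _) _ _]mxE.
Qed.

End HypergeometricPencil.

(** * The operator S as differentiation along g *)

Section ShiftOperator.
Variables (R : realType) (m : nat).
Local Notation F := (Cplx R).
Implicit Types (b c : 'I_m -> F) (v w : 'I_m -> 'cV[F]_m).

Lemma horner_derivn_sum (t : 'I_m -> F) (p : 'I_m -> {poly F}) n x :
  (\sum_l t l *: p l)^`(n).[x] = \sum_l t l * (p l)^`(n).[x].
Proof.
rewrite raddf_sum horner_sum; apply: eq_bigr => l _.
by rewrite /= derivnZ hornerZ.
Qed.

(** Both sides have degree less than m, so the nodes decide. At [b j] only the term l = j survives,
    and [Xmx b k j] is exactly the ratio of (conodal k)' to conodal j there. *)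
Lemma Xmx_conodal b k : injective b ->
  \sum_l Xmx b k l *: conodal b l = (conodal b k)^`().
Proof.
move=> bI; apply: (eq_poly_nodes bI).
- apply: (leq_trans (size_sum _ _ _)); apply/bigmax_leqP => l _.
  by rewrite (leq_trans (size_scale_leq _ _)) // size_conodal.
- by rewrite -[leqRHS](size_conodal b k) ltnW // lt_size_deriv // monic_neq0 // monic_conodal.
- move=> j; rewrite horner_sum (bigD1 j) //= big1 => [|l lj]; last first.
    by rewrite hornerZ conodal_node 1?eq_sym // mulr0.
  rewrite addr0 hornerZ mxE; case: eqP => [->|/eqP kj].
    rewrite deriv_conodal_eq // -sumrN; congr (_ * _); apply: eq_bigr => l _.
    by rewrite -invrN opprB.
  by rewrite deriv_conodal_neq.
Qed.

Definition conodal_dcol b n x : 'cV[F]_m := \col_k (conodal b k)^`(n).[x].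

Lemma conodal_dcol0 b x : conodal_dcol b 0 x = conodal_col b x.
Proof. by apply/colP => k; rewrite !mxE. Qed.

Lemma Xmx_conodal_dcol b n x : injective b ->
  Xmx b *m conodal_dcol b n x = conodal_dcol b n.+1 x.
Proof.
move=> bI; apply/colP => k; rewrite [RHS]mxE derivSn -Xmx_conodal //.
rewrite horner_derivn_sum mxE; apply: eq_bigr => l _.
by rewrite [conodal_dcol _ _ _ _ _]mxE.
Qed.

Lemma Smx_conodal_dcol b v n x : injective b -> cols v \in unitmx ->
  Smx b v *m (cols v *m conodal_dcol b n x) = cols v *m conodal_dcol b n.+1 x.
Proof.
by move=> bI vU; rewrite /Smx -!mulmxA mulKmx // Xmx_conodal_dcol.
Qed.

Lemma exp_Smx_conodal_dcol b v n k x : injective b -> cols v \in unitmx ->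
  Smx b v ^+ k *m (cols v *m conodal_dcol b n x) =
  cols v *m conodal_dcol b (k + n) x.
Proof.
move=> bI vU; elim: k n => [|k IHk] n; first by rewrite expr0 mul1mx.
by rewrite exprSr -mulmxE -mulmxA Smx_conodal_dcol // IHk addnS addSn.
Qed.

Lemma exp_Smx_conodal b v k x : injective b -> cols v \in unitmx ->
  Smx b v ^+ k *m (cols v *m conodal_col b x) = cols v *m conodal_dcol b k x.
Proof.
by move=> bI vU; rewrite -conodal_dcol0 exp_Smx_conodal_dcol // addn0.
Qed.

(** The m-th derivative of g vanishes, its coordinates having degree less than m, and the vectors
    g(b_j) span the space. *)
Lemma Smx_nilpotent b v : injective b -> cols v \in unitmx ->
  Smx b v ^+ m = 0.
Proof.
move=> bI vU; suff: Smx b v ^+ m *m cols v = 0.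
  by move=> /(congr1 (mulmx^~ (invmx (cols v)))); rewrite mul0mx mulmxK.
apply: (eq_mx_nodes bI) => j; rewrite mul0mx -mulmxA exp_Smx_conodal //.
suff -> : conodal_dcol b m (b j) = 0 by rewrite mulmx0.
by apply/colP => k; rewrite !mxE derivn_poly0 ?horner0 // size_conodal.
Qed.

Lemma scalemx_exp (N : 'M[F]_m) (t : F) k : (t *: N) ^+ k = t ^+ k *: N ^+ k.
Proof.
elim: k => [|k IHk]; first by rewrite !expr0 scale1r.
by rewrite !exprS IHk -!mulmxE -scalemxAl -scalemxAr scalerA.
Qed.

(** The partial sums are constant from index [d] on. *)
Lemma mxexp_nilpotent (N : 'M[F]_m) d (t : F) : N ^+ d = 0 ->
  mxexp (t *: N) = \sum_(k < d) ((k`!%:R)^-1 * t ^+ k) *: N ^+ k.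
Proof.
move=> Nd; apply: lim_near_cst; first exact: norm_hausdorff.
exists d => // n /= dn; rewrite /series /= (big_cat_nat _ dn) //=.
rewrite [X in _ + X]big_nat [X in _ + X]big1 ?addr0 => [|k /andP[dk _]].
  by rewrite big_mkord; apply: eq_bigr => k _; rewrite scalemx_exp scalerA.
have Nk : N ^+ k = 0 by rewrite -(subnK dk) exprD Nd mulr0.
by rewrite scalemx_exp Nk !scaler0.
Qed.

(* Taylor's formula: S acts on the span of the vectors g(x) as d/dx. *)
Lemma mxexp_Smx_conodal b v t x : injective b -> cols v \in unitmx ->
  mxexp (t *: Smx b v) *m (cols v *m conodal_col b x) =
  cols v *m conodal_col b (x + t).
Proof.
move=> bI vU; rewrite (mxexp_nilpotent _ (Smx_nilpotent bI vU)) mulmx_suml.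
have -> : conodal_col b (x + t) =
    \sum_(k < m) ((k`!%:R)^-1 * t ^+ k) *: conodal_dcol b k x.
  apply/colP => l; rewrite mxE summxE (@nderiv_taylor_wide _ m); first last.
  - by rewrite size_conodal.
  - exact: mulrC.
  (* The Taylor formula used here has derivatives already divided by k!; the factorials cancel in
     characteristic zero. *)
  apply: eq_bigr => k _; rewrite !mxE nderivn_def hornerMn -[_.[_] *+ _]mulr_natr.
  rewrite [RHS]mulrC !mulrA; congr (_ * _).
  by rewrite mulfK // pnatr_eq0 -lt0n fact_gt0.
rewrite mulmx_sumr; apply: eq_bigr => k _.
by rewrite -scalemxAl exp_Smx_conodal // scalemxAr.
Qed.

(** The entries of [Xmx] are homogeneous of degree -1 in the nodes. This sign becomes the one in
    exp(-nS) at infinity. *)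
Lemma Smx_opp b v : Smx (fun i => - b i) v = - Smx b v.
Proof.
rewrite /Smx -mulNmx -mulmxN; congr (_ *m _ *m _).
apply/matrixP => i j; rewrite !mxE; case: ifP => _.
  by congr (- _); rewrite -sumrN; apply: eq_bigr => k _; rewrite -opprD invrN.
by rewrite -opprD invrN.
Qed.

End ShiftOperator.

Section ShiftOperatorSymmetry.
Variables (R : realType) (m : nat) (B C : 'M[Cplx R]_m) (b c : 'I_m -> Cplx R).
Variables (v w : 'I_m -> 'cV[Cplx R]_m) (u : 'cV[Cplx R]_m).
Hypotheses (bI : injective b) (cI : injective c).
Hypothesis ev : forall i, v i != 0 /\ B *m v i = b i *: v i.
Hypothesis ew : forall i, w i != 0 /\ C *m w i = - c i *: w i.
Hypotheses (sv : \sum_i v i = u) (sw : \sum_i w i = u).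
Hypothesis rk1 : forall y : 'cV_m, exists s, (B + C) *m y = s *: u.

(** Both operators send g(x) to g'(x), since g is the same curve in either eigenbasis, and the
    vectors g(b_j) span. *)
Lemma Smx_sym : Smx c w = Smx b v.
Proof.
have NcI : injective (fun i => - c i) by move=> i j /oppr_inj /cI.
have wU := eigen_cols_unit NcI ew; have vU := eigen_cols_unit bI ev.
suff: Smx c w *m cols v = Smx b v *m cols v.
  by move=> /(congr1 (mulmx^~ (invmx (cols v)))); rewrite !mulmxK.
apply: (eq_mx_nodes bI) => j.
have E1 : Smx c w *m (cols v *m conodal_col b (b j)) = cols w *m conodal_dcol c 1 (b j).
  by rewrite (cols_conodal_eq cI ev ew sv sw rk1) -conodal_dcol0 Smx_conodal_dcol.
have E2 : Smx b v *m (cols v *m conodal_col b (b j)) = cols v *m conodal_dcol b 1 (b j).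
  by rewrite -conodal_dcol0 Smx_conodal_dcol.
rewrite -(mulmxA (Smx c w)) -(mulmxA (Smx b v)) E1 E2.
have dE (a : 'I_m -> Cplx R) x : conodal_dcol a 1 x = \col_k (conodal a k)^`().[x].
  by apply/colP => k; rewrite !mxE derivn1.
rewrite !dE -(transition_deriv_conodal cI ev ew sv sw rk1).
by rewrite -mulmxA mulKVmx.
Qed.

End ShiftOperatorSymmetry.

(** * The image of A is the line of u *)

Section RankOne.
Variables (F : fieldType) (m : nat).

Lemma char_poly_conj (P M : 'M[F]_m) : P \in unitmx ->
  char_poly (invmx P *m M *m P) = char_poly M.
Proof.
move=> PU; have PX : map_mx polyC P \in unitmx by rewrite map_unitmx.
rewrite /char_poly /char_poly_mx !map_mxM map_invmx.
have XE : 'X%:M = invmx (map_mx polyC P) *m 'X%:M *m map_mx polyC P.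
  by rewrite -mulmxA -scalar_mxC mulKmx.
rewrite [in LHS]XE -mulmxBl -mulmxBr !det_mulmx mulrAC.
by rewrite -(det_mulmx (invmx _)) mulVmx // det1 mul1r.
Qed.

(** The characteristic polynomial leaves one nonzero entry on the diagonal, so the image is a line;
    it contains [a *: u], hence [u], because [a] is nonzero. *)
Lemma rank_one_image (A : 'M[F]_m) (a : F) (u : 'cV[F]_m) (y : 'cV[F]_m) :
  diagonalizable A -> a != 0 ->
  char_poly A = ('X - a%:P) * 'X ^+ m.-1 -> u != 0 -> A *m u = a *: u ->
  exists s, A *m y = s *: u.
Proof.
move=> [P PU /(similar_diagLR PU)[D AE]] a0 cA u0 Au.
have {}AE : A = invmx P *m diag_mx D *m P.
  by rewrite AE conjumx ?unitmx_inv // invmxK.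
have /prod_XsubC_eq/permPl pD :
    \prod_(x <- [seq D 0 i | i <- enum 'I_m]) ('X - x%:P) =
    \prod_(x <- a :: nseq m.-1 0) ('X - x%:P).
  rewrite big_cons big_nseq big_map enumT subr0.
  rewrite -Monoid.iteropE -[RHS]cA AE char_poly_conj // char_poly_trig ?diag_mx_is_trig //.
  by apply: eq_bigr => i _; rewrite mxE eqxx.
have /mapP[i0 _ Di0] : a \in [seq D 0 i | i <- enum 'I_m].
  by rewrite (perm_mem (permEl pD)) mem_head.
have Dj j : j != i0 -> D 0 j = 0.
  move=> ji; apply/eqP; apply: contraNT ji => Dj.
  (* The diagonal is known only up to a permutation, which does not affect the number of nonzero
     entries. *)
  have c1 : #|[pred i | D 0 i != 0]| = 1%N.
    transitivity (count (predC1 0) [seq D 0 i | i <- enum 'I_m]).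
      by rewrite count_map -size_filter enumT cardE.
    rewrite (seq.permP (permEl pD)) /=.
    by rewrite a0 count_nseq /= eqxx mul0n.
  have /card_le1_eqP e : (#|[pred i | D 0%R i != 0%R]| <= 1)%N by rewrite c1.
  by apply/eqP; apply: e; rewrite inE -?Di0.
have Ay (z : 'cV_m) : A *m z = ((P *m z) i0 0 * a) *: (invmx P *m delta_mx i0 0).
  rewrite AE -!mulmxA [RHS]scalemxAr; congr (_ *m _).
  apply/colP => k; rewrite mul_diag_mx !mxE eqxx andbT; case: eqP => [->|/eqP kj].
    by rewrite -Di0 mulr1 mulrC.
  by rewrite Dj // mul0r mulr0.
have := Ay u; rewrite Au Ay.
set x := invmx P *m _; set k := (P *m u) i0 0; set l := (P *m y) i0 0 => ue.
have k0 : k != 0.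
  apply: contra_eq_neq ue => ->; rewrite mul0r scale0r scaler_eq0 negb_or a0 //.
exists (l / k * a).
by rewrite -[RHS]scalerA ue scalerA mulrA divfK.
Qed.

End RankOne.

(** * Real-valued absolute value of a complex number *)

Section Modulus.
Variable R : realType.
Local Notation C := (Cplx R).
Implicit Types z w : C.

(** The norm on [Cplx R] takes its values in [Cplx R] itself; this is the same number as an element
    of [R], where estimates can use the total order. *)
Definition modulus z : R := complex.Re `|z|.

Lemma norm_modulus z : `|z| = (modulus z)%:C%C.
Proof. by []. Qed.

Lemma modulus_ge0 z : 0 <= modulus z.
Proof. by have := normr_ge0 z; rewrite norm_modulus (ler0c (modulus z)). Qed.

Lemma modulusM z w : modulus (z * w) = modulus z * modulus w.
Proof. by rewrite /modulus normrM !norm_modulus -(rmorphM (real_complex R)). Qed.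

Lemma modulusD z w : modulus (z + w) <= modulus z + modulus w.
Proof.
have := ler_normD z w; rewrite !norm_modulus -(rmorphD (real_complex R)).
by rewrite (lecR (modulus _)).
Qed.

Lemma modulusN z : modulus (- z) = modulus z.
Proof. by rewrite /modulus normrN. Qed.

Lemma modulusB z w : modulus (z - w) <= modulus z + modulus w.
Proof. by rewrite -(modulusN w) modulusD. Qed.

Lemma modulus0 : modulus 0 = 0.
Proof. by rewrite /modulus normr0. Qed.

Lemma modulus1 : modulus 1 = 1.
Proof. by rewrite /modulus normr1. Qed.

Lemma modulusX z n : modulus (z ^+ n) = modulus z ^+ n.
Proof.
by elim: n => [|n IHn]; rewrite ?expr0 ?modulus1 // !exprS modulusM IHn.
Qed.

Lemma modulus_eq0 z : (modulus z == 0) = (z == 0).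
Proof.
rewrite -[RHS]normr_eq0 norm_modulus; apply/eqP/eqP => [->//|].
by move=> /(congr1 (@complex.Re R)).
Qed.

Lemma modulus_real (x : R) : modulus (x%:C%C : C) = `|x|.
Proof. by rewrite /modulus normc_def /= expr0n /= addr0 sqrtr_sqr. Qed.

Lemma modulus_nat n : modulus n%:R = n%:R.
Proof. by rewrite /modulus normr_nat -(rmorph_nat (real_complex R)). Qed.

Lemma modulusV z : modulus z^-1 = (modulus z)^-1.
Proof.
have [->|z0] := eqVneq z 0; first by rewrite invr0 modulus0 invr0.
have mz0 : modulus z != 0 by rewrite modulus_eq0.
by apply: (mulfI mz0); rewrite -modulusM !mulfV // modulus1.
Qed.

Lemma Re_modulus z : `|complex.Re z| <= modulus z.
Proof. by have := normc_ge_Re z; rewrite (lecR `|complex.Re z|). Qed.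

Lemma Im_modulus z : `|complex.Im z| <= modulus z.
Proof.
rewrite /modulus normc_def /= -sqrtr_sqr ler_wsqrtr // lerDr sqr_ge0 //.
Qed.

Lemma modulus_ReIm z : modulus z <= `|complex.Re z| + `|complex.Im z|.
Proof.
rewrite /modulus normc_def /= -[leRHS]ger0_norm ?addr_ge0 // -sqrtr_sqr.
rewrite ler_wsqrtr // sqrrD !real_normK ?num_real // addrAC lerDl.
by rewrite mulrn_wge0 // mulr_ge0.
Qed.

Lemma norm_lt_real z (x : R) : (`|z| < x%:C%C :> C) = (modulus z < x).
Proof. by rewrite norm_modulus (ltcR (modulus _)). Qed.

Lemma norm_le_real z (x : R) : (`|z| <= x%:C%C :> C) = (modulus z <= x).
Proof. by rewrite norm_modulus (lecR (modulus _)). Qed.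

Lemma norm_lt1 z : (`|z| < 1) = (modulus z < 1).
Proof. exact: norm_lt_real. Qed.

Lemma norm_gt1 z : (1 < `|z|) = (1 < modulus z).
Proof. by rewrite norm_modulus -(ltcR 1). Qed.

Lemma posc_real (e : C) : 0 < e -> exists2 r : R, 0 < r & e = r%:C%C.
Proof.
move=> e0; exists (modulus e).
  by rewrite lt_neqAle modulus_ge0 andbT eq_sym modulus_eq0 gt_eqF.
by rewrite -norm_modulus gtr0_norm.
Qed.

Lemma cvg_modulusP (T : Type) (F : set_system T) (FF : Filter F) (f : T -> C) l :
  f @ F --> l <-> forall e : R, 0 < e -> \forall t \near F, modulus (l - f t) < e.
Proof.
split=> [/cvgrPdist_lt fl e e0|fl].
  have := fl e%:C%C; rewrite (ltcR 0 e) => /(_ e0).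
  by apply: filterS => t; rewrite norm_lt_real.
apply/cvgrPdist_lt => e /posc_real[r r0 ->].
by apply: filterS (fl r r0) => t; rewrite norm_lt_real.
Qed.

Lemma cvg_ReIm (T : Type) (F : set_system T) (FF : Filter F) (f : T -> C) (x y : R) :
  (fun t => complex.Re (f t)) @ F --> x -> (fun t => complex.Im (f t)) @ F --> y ->
  f @ F --> ((x +i* y)%C : C).
Proof.
move=> /cvgrPdist_lt fx /cvgrPdist_lt fy; apply/cvg_modulusP => e e0.
have e2 : 0 < e / 2 by rewrite divr_gt0.
near=> t; apply: (le_lt_trans (modulus_ReIm _)).
rewrite [ltRHS](splitr e) ltrD //.
- by have : `|x - complex.Re (f t)| < e / 2 by [near: t; exact: fx]; case: (f t).
- by have : `|y - complex.Im (f t)| < e / 2 by [near: t; exact: fy]; case: (f t).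
Unshelve. all: by end_near. Qed.

Lemma modulus_lim_le (u : nat -> C) l (K : R) :
  u @ \oo --> l -> (forall n, modulus (u n) <= K) -> modulus l <= K.
Proof.
move=> /cvg_modulusP ul uK; apply/ler_addgt0Pr => e e0.
have [N _ /(_ N (leqnn N)) lN] := ul e e0.
rewrite -[l](subrK (u N)) (le_trans (modulusD _ _)) // addrC lerD // ltW //.
Qed.

End Modulus.

(** * Derivatives in one variable over a normed field *)

Section DerivativeEstimates.
Variables (K : numFieldType) (V : normedModType K).

(** Free of division, the bound also holds at h = 0, so the neighbourhood is not punctured and an
    increment tending to 0 can replace [h] without being shown nonzero. *)
Lemma is_derive_epsP (f : K -> V) (x : K) d :
  is_derive x (1 : K) f d <->
  (forall e : K, 0 < e ->
     \forall h \near (0 : K), `|f (h + x) - f x - h *: d| <= e * `|h|).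
Proof.
split=> [fd e e0|fd].
  have /cvgrPdist_le/(_ e e0) : h^-1 *: (f (h *: 1 + x) - f x) @[h --> 0^'] --> d.
    by case: fd => fx <-; apply: fx.
  rewrite near_withinE; apply: filterS => h hd.
  have [->|h0] := eqVneq h 0; first by rewrite add0r subrr scale0r subr0 !normr0 mulr0.
  have := hd h0; rewrite -(ler_pM2r (_ : 0 < `|h|)) ?normr_gt0 //.
  rewrite mulrC -normrZ scalerBr scalerA mulfV // scale1r distrC.
  by rewrite /GRing.scale /= mulr1.
have cv : h^-1 *: (f (h *: 1 + x) - f x) @[h --> 0^'] --> d.
  apply/cvgrPdist_le => e e0; rewrite near_withinE.
  apply: filterS (fd e e0) => h hd h0.
  rewrite -(ler_pM2r (_ : 0 < `|h|)) ?normr_gt0 //.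
  rewrite mulrC -normrZ scalerBr scalerA mulfV // scale1r distrC.
  by rewrite /GRing.scale /= mulr1.
apply: DeriveDef; first by apply/cvg_ex; exists d.
exact: (cvg_lim (@norm_hausdorff _ _) cv).
Qed.

Lemma is_derive_quad (f : K -> V) (x : K) d (M : K) : 0 < M ->
  (\forall h \near (0 : K), `|f (h + x) - f x - h *: d| <= M * `|h| ^+ 2) ->
  is_derive x (1 : K) f d.
Proof.
move=> M0 fM; apply/is_derive_epsP => e e0.
near=> h.
have /le_trans -> // : `|f (h + x) - f x - h *: d| <= M * `|h| ^+ 2 by near: h.
rewrite expr2 mulrA ler_wpM2r // -ler_pdivlMl // mulrC.
near: h; exact: (@nbhs0_le K K _ (divr_gt0 e0 M0)).
Unshelve. all: by end_near. Qed.

End DerivativeEstimates.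

Section ScalarDerivatives.
Variable K : numFieldType.

(** On the field itself the differential is linear, hence multiplication by its value at 1. *)
Lemma is_derive_scomp (f g : K -> K) (x : K) a b :
  is_derive (g x) (1 : K) f a -> is_derive x (1 : K) g b ->
  is_derive x (1 : K) (f \o g) (a * b).
Proof.
move=> fa gb.
have df : differentiable f (g x) by apply/derivable1_diffP.
have dg : differentiable g x by apply/derivable1_diffP.
have dfg : differentiable (f \o g) x by exact: differentiable_comp.
apply: DeriveDef; first by apply/derivable1_diffP.
have -> : 'D_(1 : K) (f \o g) x = 'd f (g x) b.
  rewrite (deriveE _ dfg) (congr1 (fun h => h (1 : K)) (diff_comp dg df)).
  by rewrite -(@derive_val _ _ _ _ _ _ _ gb) (deriveE _ dg).
have -> : 'd f (g x) b = b *: 'd f (g x) (1 : K) by rewrite -linearZ /= [_ *: _]mulr1.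
by rewrite -(deriveE _ df) derive_val [_ *: _]mulrC.
Qed.

Lemma is_derive_mx m n (f : K -> 'M[K]_(m, n)) (x : K) (d : 'M[K]_(m, n)) :
  (forall i j, is_derive x (1 : K) (fun y => f y i j) (d i j)) -> is_derive x (1 : K) f d.
Proof.
move=> fd.
have cv : h^-1 *: (f (h *: 1 + x) - f x) @[h --> 0^'] --> d.
  apply/cvg_ballP => e e0.
  have /filterS : \forall h \near 0^', forall i j,
     ball (d i j) e (h^-1 *: (f (h *: 1 + x) i j - f x i j)).
    apply: filter_forall => i; apply: filter_forall => j.
    by case: (fd i j) => fx <-; move/cvg_ballP: fx; apply.
  apply => h H; split=> // i j; rewrite !mxE; exact: H.
apply: DeriveDef; first by apply/cvg_ex; exists d.
exact: (cvg_lim (@norm_hausdorff _ _) cv).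
Qed.

Lemma is_derive_mul (f g : K -> K) (x : K) (df dg : K) :
  is_derive x (1 : K) f df -> is_derive x (1 : K) g dg ->
  is_derive x (1 : K) (fun y => f y * g y) (f x * dg + df * g x).
Proof.
move=> fd gd; apply: (is_derive_eq (is_deriveM fd gd)).
by rewrite /GRing.scale /= [g x * _]mulrC.
Qed.

Lemma is_derive_inv (x : K) : x != 0 ->
  is_derive x (1 : K) (fun y => y^-1) (- x ^- 2).
Proof.
move=> x0; apply: DeriveDef.
  exact: (derivableV (f := id) x0 (@derivable_id _ _ _ _)).
rewrite (deriveV (f := id) x0 (@derivable_id _ _ _ _)) derive_id.
by rewrite /GRing.scale /= mulr1.
Qed.

Lemma is_derive_scale_comp m (f g : K -> K) (F : K -> 'cV[K]_m) (x : K)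
    (df dg : K) (dF : 'cV[K]_m) :
  is_derive x (1 : K) f df -> is_derive x (1 : K) g dg ->
  (forall p, is_derive (g x) (1 : K) (fun y => F y p 0) (dF p 0)) ->
  is_derive x (1 : K) (fun y => f y *: F (g y))
    ((f x * dg) *: dF + df *: F (g x)).
Proof.
move=> fd gd Fd; apply: is_derive_mx => p q; rewrite (ord1 q).
have h := is_derive_mul fd (is_derive_scomp (Fd p) gd).
have -> : (fun y => (f y *: F (g y)) p 0) =
    (fun y => f y * ((fun y => F y p 0) \o g) y).
  by apply/funext => y; rewrite mxE.
by apply: (is_derive_eq h); rewrite !mxE /=; ring.
Qed.

End ScalarDerivatives.

(** * Complex series dominated by a geometric one *)

Section BoundedSeries.
Variable R : realType.
Local Notation C := (Cplx R).

Lemma cvg_mx_entries (T : Type) (F : set_system T) (FF : Filter F) p q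
    (f : T -> 'M[C]_(p, q)) (l : 'M[C]_(p, q)) :
  (forall i j, (fun t => f t i j) @ F --> l i j) -> f @ F --> l.
Proof.
move=> fl; apply/cvg_ballP => e e0.
have /filterS : \forall t \near F, forall i j, ball (l i j) e (f t i j).
  apply: filter_forall => i; apply: filter_forall => j.
  by have /cvg_ballP := fl i j; apply.
by apply=> t; split.
Qed.

Lemma series_geometric_le (K r : R) n : 0 <= K -> 0 <= r < 1 ->
  \sum_(0 <= k < n) K * r ^+ k <= K / (1 - r).
Proof.
move=> K0 /andP[r0 r1]; rewrite -mulr_sumr ler_wpM2l // big_mkord.
rewrite -[leRHS]mul1r ler_pdivlMr ?subr_gt0 // mulrC -opprB mulNr -subrX1 opprB gerBl.
exact: exprn_ge0.
Qed.

Lemma cvg_series_le_geometric (a : nat -> C) (K r : R) : 0 <= r < 1 ->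
  (forall n, modulus (a n) <= K * r ^+ n) -> cvgn (series a).
Proof.
move=> /andP[r0 r1] aK.
have K0 : 0 <= K.
  by rewrite (le_trans (modulus_ge0 (a 0%N))) // (le_trans (aK 0%N)) // expr0 mulr1.
(* [p] stands for the real and for the imaginary part: all that matters is additivity and domination
   by the modulus. *)
have cvr (p : C -> R) : (forall z, `|p z| <= modulus z) ->
    (forall z w, p (z + w) = p z + p w) ->
    exists l : R, (fun n => p (series a n)) @ \oo --> l.
  move=> pm pD.
  have p0 : p 0 = 0 by apply: (addrI (p 0)); rewrite -pD !addr0.
  have pS n : p (series a n) = series (p \o a) n.
    rewrite /series /=; elim: n => [|n IHn]; first by rewrite !big_geq.
    by rewrite !big_nat_recr //= pD IHn.
  apply/cvg_ex; under eq_fun do rewrite pS.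
  apply: normed_cvg; apply: (series_le_cvg (v_ := geometric K r)) => [n|n|n|].
  - exact: normr_ge0.
  - by rewrite mulr_ge0 // exprn_ge0.
  - exact: le_trans (pm _) (aK n).
  - by apply: is_cvg_geometric_series; rewrite ger0_norm.
have [x ax] := cvr (@complex.Re R) (@Re_modulus R)
  (fun z w => ltac:(by case: z w => ? ? [? ?])).
have [y ay] := cvr (@complex.Im R) (@Im_modulus R)
  (fun z w => ltac:(by case: z w => ? ? [? ?])).
by apply/cvg_ex; exists (x +i* y)%C; apply: cvg_ReIm.
Qed.

Lemma series_lim_le_geometric (a : nat -> C) (K r : R) l : 0 <= r < 1 ->
  (forall n, modulus (a n) <= K * r ^+ n) -> series a @ \oo --> l ->
  modulus l <= K / (1 - r).
Proof.
move=> r01 aK al; apply: (modulus_lim_le al) => n.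
have K0 : 0 <= K.
  by rewrite (le_trans (modulus_ge0 (a 0%N))) // (le_trans (aK 0%N)) // expr0 mulr1.
apply: le_trans (series_geometric_le n K0 r01); rewrite /series /=.
elim: n => [|n IHn]; first by rewrite !big_geq // modulus0.
by rewrite !big_nat_recr //= (le_trans (modulusD _ _)) // lerD.
Qed.

End BoundedSeries.

(** * Power series with radius of convergence at least 1 *)

Section PowerSeries.
Variable R : realType.
Local Notation C := (Cplx R).
Implicit Types (a : nat -> C) (z : C).

(* By the Cauchy-Hadamard formula this says that the radius of convergence of
   sum_n a_n z^n is at least 1. *)
Definition subgeometric a := forall r : R, 0 < r < 1 ->
  exists K : R, forall n, modulus (a n) * r ^+ n <= K.

Lemma subgeometric_cst (x : C) : subgeometric (fun=> x).
Proof.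
move=> r /andP[r0 r1]; exists (modulus x) => n.
by rewrite ler_piMr ?modulus_ge0 // exprn_ile1 // ltW.
Qed.

Lemma subgeometricD a a' : subgeometric a -> subgeometric a' ->
  subgeometric (fun n => a n + a' n).
Proof.
move=> ha ha' r r01; have [K hK] := ha r r01; have [K' hK'] := ha' r r01.
exists (K + K') => n; apply: le_trans (lerD (hK n) (hK' n)).
rewrite -mulrDl ler_wpM2r ?modulusD // exprn_ge0 // ltW //.
by case/andP: r01.
Qed.

(** Writing r as the square of its root gives each sequence a factor that is still less than 1. *)
Lemma subgeometricM a a' : subgeometric a -> subgeometric a' ->
  subgeometric (fun n => a n * a' n).
Proof.
move=> ha ha' r /andP[r0 r1].
have s01 : 0 < Num.sqrt r < 1 by rewrite sqrtr_gt0 r0 /= -[ltRHS]sqrtr1 ltr_sqrt.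
have [K hK] := ha _ s01; have [K' hK'] := ha' _ s01.
exists (K * K') => n.
rewrite modulusM -[r in r ^+ n]sqr_sqrtr ?(ltW r0) // expr2 exprMn mulrACA.
by rewrite ler_pM // mulr_ge0 ?modulus_ge0 // exprn_ge0 // ltW; case/andP: s01.
Qed.

Lemma subgeometric_sum (I : Type) (s : seq I) (P : pred I) (a : I -> nat -> C) :
  (forall i, subgeometric (a i)) ->
  subgeometric (fun n => \sum_(i <- s | P i) a i n).
Proof.
move=> ha; elim: s => [|i s IHs].
  by under eq_fun do rewrite big_nil; exact: (@subgeometric_cst 0).
under eq_fun do rewrite big_cons.
by case: (P i); [exact: subgeometricD|exact: IHs].
Qed.

(** n r^n is at most the sum of the r^k for k < n, hence at most 1 / (1 - r). *)
Lemma subgeometric_nat : subgeometric (fun n => n%:R).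
Proof.
move=> r /andP[r0 r1]; exists (1 - r)^-1 => n; rewrite modulus_nat.
apply: (@le_trans _ _ (\sum_(0 <= k < n) 1 * r ^+ k)); last first.
  by rewrite -[leRHS]mul1r series_geometric_le ?ler01 ?(ltW r0).
rewrite mulr_natl -[n in _ *+ n]subn0 -sumr_const_nat big_nat [leRHS]big_nat.
apply: ler_sum => k /andP[_ kn]; rewrite mul1r.
by rewrite ler_wiXn2l ?ltW // ltnW.
Qed.

Lemma subgeometricX a k : subgeometric a -> subgeometric (fun n => a n ^+ k).
Proof.
move=> ha; elim: k => [|k IHk].
  by under eq_fun do rewrite expr0; exact: subgeometric_cst.
by under eq_fun do rewrite exprS; exact: subgeometricM.
Qed.

Lemma subgeometric_shift a : subgeometric a ->
  subgeometric (fun n => if n is k.+1 then a k else 0).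
Proof.
move=> ha r r01; have [K hK] := ha r r01; case/andP: r01 => r0 r1.
exists K => -[|n].
  rewrite modulus0 mul0r (le_trans _ (hK 0%N)) //.
  by rewrite expr0 mulr1 modulus_ge0.
rewrite (le_trans _ (hK n)) // ler_wpM2l ?modulus_ge0 //.
by rewrite exprS ler_piMl // ?ltW // exprn_gt0.
Qed.

Lemma subgeometricS a : subgeometric a -> subgeometric (fun n => a n.+1).
Proof.
move=> ha r r01; have [K hK] := ha r r01; case/andP: r01 => r0 r1.
exists (K / r) => n; rewrite ler_pdivlMr // -mulrA -exprSr; exact: hK.
Qed.

(** Boundedness at the intermediate radius [s] becomes geometric decay, with ratio r / s, at the
    smaller radius [r]. *)
Lemma subgeometric_le a (r : R) : 0 <= r < 1 -> subgeometric a ->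
  exists K q : R, 0 <= q < 1 /\ forall n, modulus (a n) * r ^+ n <= K * q ^+ n.
Proof.
move=> /andP[r0 r1] ha; pose s := (r + 1) / 2.
have s1 : s < 1 by rewrite /s; lra.
have s0 : 0 < s by rewrite /s; lra.
have rs : r < s by rewrite /s; lra.
have [K hK] := ha s ltac:(by rewrite s0 s1).
exists K, (r / s); split.
  by rewrite divr_ge0 ?(ltW s0) //= ltr_pdivrMr // mul1r.
move=> n; rewrite expr_div_n mulrA ler_pdivlMr ?exprn_gt0 // mulrAC.
by rewrite ler_wpM2r // exprn_ge0.
Qed.

Definition pser a z : C := limn (series (fun n => a n * z ^+ n)).

Lemma pser_cvg a z : subgeometric a -> modulus z < 1 ->
  series (fun n => a n * z ^+ n) @ \oo --> pser a z.
Proof.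
move=> ha z1.
have [K [q [q01 hK]]] := subgeometric_le (r := modulus z) ltac:(by rewrite modulus_ge0) ha.
apply: (cvg_series_le_geometric q01 (K := K)) => n.
by rewrite modulusM modulusX.
Qed.

Lemma pser_unique a z l : series (fun n => a n * z ^+ n) @ \oo --> l ->
  pser a z = l.
Proof. exact: cvg_lim. Qed.

Lemma pserD a a' z : subgeometric a -> subgeometric a' -> modulus z < 1 ->
  pser (fun n => a n + a' n) z = pser a z + pser a' z.
Proof.
move=> ha ha' z1; apply: pser_unique.
under eq_fun do rewrite mulrDl.
rewrite -[X in series X]/((fun n => a n * z ^+ n) + (fun n => a' n * z ^+ n)) seriesD.
by apply: cvgD; exact: pser_cvg.
Qed.

Lemma pserZ a x z : subgeometric a -> modulus z < 1 ->
  pser (fun n => x * a n) z = x * pser a z.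
Proof.
move=> ha z1; apply: pser_unique.
under eq_fun do rewrite -mulrA.
rewrite -[X in series X]/(x *: (fun n => a n * z ^+ n)) seriesZ.
by apply: cvgZl_tmp; exact: pser_cvg.
Qed.

Lemma pser_sum (I : Type) (s : seq I) (a : I -> nat -> C) z :
  (forall i, subgeometric (a i)) -> modulus z < 1 ->
  pser (fun n => \sum_(i <- s) a i n) z = \sum_(i <- s) pser (a i) z.
Proof.
move=> ha z1; elim: s => [|i s IHs].
  rewrite big_nil; under eq_fun do rewrite big_nil -(mul0r 0).
  by rewrite pserZ ?mul0r //; exact: subgeometric_cst.
under eq_fun do rewrite big_cons.
by rewrite big_cons pserD // ?IHs //; exact: subgeometric_sum.
Qed.

Lemma pser_shift a z : subgeometric a -> modulus z < 1 ->
  pser (fun n => if n is k.+1 then a k else 0) z = z * pser a z.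
Proof.
move=> ha z1; apply: pser_unique; rewrite -cvg_shiftS.
rewrite (_ : (fun _ => _) = z *: series (fun n => a n * z ^+ n)).
  by apply: cvgZl_tmp; exact: pser_cvg.
apply/funext => n; rewrite /series /= big_nat_recl //= mul0r add0r.
rewrite -[RHS]/(z * _) mulr_sumr; apply: eq_bigr => k _.
by rewrite exprS mulrCA.
Qed.

(** The remainders satisfy E_(n+1) = (h + z) E_n + n h^2 z^(n-1), and n^2 + n <= (n + 1)^2 closes
    the induction. Dividing by [r ^+ 2] avoids a truncated exponent n - 2. *)
Lemma modulus_pow_taylor_le (z h : C) (r : R) n : 0 < r ->
  modulus z <= r -> modulus (h + z) <= r ->
  modulus ((h + z) ^+ n - z ^+ n - h * (n%:R * z ^+ n.-1)) <=
    modulus h ^+ 2 / r ^+ 2 * (n%:R ^+ 2 * r ^+ n).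
Proof.
move=> r0 zr hzr; elim: n => [|n IHn].
  by rewrite !expr0 subrr !mul0r mulr0 subr0 modulus0 expr0n /= mul0r mulr0.
set E := (X in modulus X <= _) in IHn *.
have -> : (h + z) ^+ n.+1 - z ^+ n.+1 - h * (n.+1%:R * z ^+ n) =
    (h + z) * E + n%:R * h ^+ 2 * z ^+ n.-1.
  rewrite /E; case: n {IHn E} => [|n]; first by rewrite !expr0 !expr1 /=; ring.
  by rewrite /= !exprS -[n.+2%:R]natr1; ring.
rewrite (le_trans (modulusD _ _)) // (modulusM _ E) (modulusM _ (z ^+ _)) (modulusM n%:R).
have hn : modulus n%:R * modulus (h ^+ 2) * modulus (z ^+ n.-1) <=
    modulus h ^+ 2 / r ^+ 2 * (n%:R * r ^+ n.+1).
  case: n {IHn E} => [|n]; first by rewrite modulus0 !mul0r mulr0.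
  have -> : modulus h ^+ 2 / r ^+ 2 * (n.+1%:R * r ^+ n.+2) =
      n.+1%:R * modulus h ^+ 2 * r ^+ n by rewrite !exprS; field; rewrite gt_eqF.
  rewrite modulus_nat !modulusX /= ler_wpM2l ?mulr_ge0 ?exprn_ge0 ?modulus_ge0 //.
  by rewrite lerXn2r // ?nnegrE ?modulus_ge0 // ltW.
apply: (@le_trans _ _ (r * (modulus h ^+ 2 / r ^+ 2 * (n%:R ^+ 2 * r ^+ n)) +
    modulus h ^+ 2 / r ^+ 2 * (n%:R * r ^+ n.+1))).
  by rewrite lerD // ler_pM ?modulus_ge0.
rewrite mulrCA -mulrDr ler_wpM2l ?divr_ge0 ?exprn_ge0 ?modulus_ge0 ?(ltW r0) //.
rewrite (_ : r * _ + _ = (n%:R ^+ 2 + n%:R) * r ^+ n.+1);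
  last by rewrite [r ^+ n.+1]exprS; ring.
rewrite ler_wpM2r ?exprn_ge0 ?(ltW r0) // -[n.+1%:R]natr1 sqrrD expr1n mulr1.
by have := ler0n R n; lra.
Qed.

(** The quadratic remainders of the monomials are summed: n^2 a_n is again subgeometric, and [r],
    midway between |z| and 1, leaves room for z + h. *)
Lemma pser_derive a z : subgeometric a -> modulus z < 1 ->
  is_derive z (1 : C) (pser a) (pser (fun n => n.+1%:R * a n.+1) z).
Proof.
move=> ha z1; pose r := (modulus z + 1) / 2.
have m0 := modulus_ge0 z.
have r0 : 0 < r by rewrite /r; lra.
have r1 : r < 1 by rewrite /r; lra.
have zr : modulus z < r by rewrite /r; lra.
have hna : subgeometric (fun n => n%:R ^+ 2 * a n).
  by apply: subgeometricM => //; apply: subgeometricX; exact: subgeometric_nat.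
have [K [q [q01 hK]]] := subgeometric_le (r := r) ltac:(by rewrite ltW) hna.
have hd : subgeometric (fun n => n.+1%:R * a n.+1).
  apply: (@subgeometricS (fun n => n%:R * a n)).
  by apply: subgeometricM => //; exact: subgeometric_nat.
(* The bound proper is [K / (1 - q) / r ^+ 2]; the rest makes the constant positive. *)
pose M := `|K / (1 - q) / r ^+ 2| + 1.
have M0 : 0 < M by rewrite ltr_wpDl.
apply: (@is_derive_quad _ _ _ _ _ M%:C%C); first by rewrite (ltcR 0).
have : \forall h \near (0 : C), `|h| <= (r - modulus z)%:C%C.
  by apply: (@nbhs0_le C C); rewrite (ltcR 0) subr_gt0.
apply: filterS => h; rewrite norm_le_real => hr.
have hzr : modulus (h + z) <= r.
  by rewrite (le_trans (modulusD _ _)) // -lerBrDr.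
rewrite norm_modulus -(rmorphXn (real_complex R)) -(rmorphM (real_complex R)) norm_le_real.
have c1 := pser_cvg ha (le_lt_trans hzr r1).
have c2 := pser_cvg ha z1.
have c3' : series (fun n => n%:R * a n * z ^+ n.-1) @ \oo -->
    pser (fun n => n.+1%:R * a n.+1) z.
  rewrite -cvg_shiftS.
  rewrite (_ : (fun _ => _) = series (fun n => n.+1%:R * a n.+1 * z ^+ n)).
    exact: pser_cvg.
  by apply/funext => n; rewrite /series /= big_nat_recl //= !mul0r add0r.
have c4 : series (fun n => a n * (h + z) ^+ n - a n * z ^+ n -
      h * (n%:R * a n * z ^+ n.-1)) @ \oo -->
    pser a (h + z) - pser a z - h *: pser (fun n => n.+1%:R * a n.+1) z.
  rewrite (_ : series _ = (fun n => series (fun n => a n * (h + z) ^+ n) n -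
    series (fun n => a n * z ^+ n) n - h * series (fun n => n%:R * a n * z ^+ n.-1) n)).
    by apply: cvgB (cvgB c1 c2) (cvgZl_tmp c3').
  by apply/funext => n; rewrite /series /= !sumrB mulr_sumr.
have hKq n : modulus (a n * (h + z) ^+ n - a n * z ^+ n - h * (n%:R * a n * z ^+ n.-1))
    <= modulus h ^+ 2 / r ^+ 2 * K * q ^+ n.
  rewrite (_ : _ - _ - _ = a n * ((h + z) ^+ n - z ^+ n - h * (n%:R * z ^+ n.-1)));
    last by ring.
  rewrite modulusM.
  rewrite (le_trans (ler_wpM2l (modulus_ge0 _) (modulus_pow_taylor_le n r0 (ltW zr) hzr))) //.
  have := hK n; rewrite modulusM modulusX modulus_nat => hKn.
  rewrite mulrCA -[leRHS]mulrA ler_wpM2l ?divr_ge0 ?exprn_ge0 ?modulus_ge0 ?(ltW r0) //.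
  by rewrite mulrCA mulrA.
have := series_lim_le_geometric q01 hKq c4.
move=> /le_trans -> //.
rewrite mulrC -[modulus h ^+ 2 / _ * K]mulrA [modulus h ^+ 2 * _]mulrC mulrA.
rewrite ler_wpM2r ?exprn_ge0 ?modulus_ge0 //.
rewrite /M (le_trans (ler_norm _)) // -[leLHS]addr0 lerD // le_eqVlt; apply/orP; left.
by apply/eqP; congr (`|_|); ring.
Qed.

End PowerSeries.

(** * The exponential and the branches of the logarithm *)

Section ComplexExponential.
Variable R : realType.
Local Notation C := (Cplx R).
Implicit Types z w : C.

Lemma cexpD z w : cexp (z + w) = cexp z * cexp w.
Proof.
case: z w => [x y] [x' y']; rewrite /cexp /= expRD cosD sinD.
by apply/eqP; rewrite eq_complex /=; apply/andP; split; apply/eqP; ring.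
Qed.

Lemma cexp0 : cexp (0 : C) = 1.
Proof.
rewrite /cexp /= expR0 cos0 sin0.
by apply/eqP; rewrite eq_complex /=; apply/andP; split; apply/eqP; ring.
Qed.

Lemma cexp_real (x : R) : cexp (x%:C%C : C) = (expR x)%:C%C.
Proof.
rewrite /cexp /= cos0 sin0.
by apply/eqP; rewrite eq_complex /=; apply/andP; split; apply/eqP; ring.
Qed.

Lemma modulus_cis (y : R) : modulus ((cos y +i* sin y)%C : C) = 1.
Proof. by rewrite /modulus normc_def /= cos2Dsin2 sqrtr1. Qed.

Lemma modulus_i : modulus ('i%C : C) = 1.
Proof. by rewrite /modulus normc_def /= expr0n /= add0r expr1n sqrtr1. Qed.

Lemma cexp_near0 (e : R) : 0 < e ->
  \forall h \near (0 : C), modulus (cexp h - 1 - h) <= e * modulus h.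
Proof.
(* Six errors of size d |h| will add up: one from the real exponential, four from cosine and sine
   multiplied by |1 + x| <= 2, one from the product x y. *)
move=> e0; pose d := Num.min 1 (e / 6).
have d0 : 0 < d by rewrite lt_min ltr01 divr_gt0.
have d1 : d <= 1 by rewrite ge_min lexx.
have de : d <= e / 6 by rewrite ge_min lexx orbT.
clearbody d.
have near0 (f : R -> R) (f0 f' : R) : f 0 = f0 -> is_derive (0 : R) (1 : R) f f' ->
    exists2 r : R, 0 < r & forall x, `|x| < r -> `|f x - f0 - x * f'| <= d * `|x|.
  move=> <- /is_derive_epsP/(_ d d0)/nbhs_ballP[r r0 hr]; exists r => // x xr.
  have := hr x; rewrite /ball /= sub0r normrN addr0; exact.
have [r1 r10 h1] := near0 _ _ _ (@expR0 R) (is_derive_expR 0).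
have [r2 r20 h2] := near0 _ _ _ (@cos0 R) (is_derive_cos 0).
have [r3 r30 h3] := near0 _ _ _ (@sin0 R) (is_derive_sin 0).
pose r := Num.min (Num.min r1 r2) (Num.min r3 d).
have r_gt0 : 0 < r by rewrite !lt_min r10 r20 r30 d0.
have : \forall h \near (0 : C), `|h| < r%:C%C.
  by apply: (@nbhs0_lt C C); rewrite (ltcR 0).
apply: filterS => h; rewrite norm_lt_real.
rewrite /r !lt_min => /andP[/andP[hr1 hr2] /andP[hr3 hrd]].
case: h hr1 hr2 hr3 hrd => x y; set h := (x +i* y)%C => hr1 hr2 hr3 hrd.
have xh : `|x| <= modulus h by exact: (Re_modulus h).
have yh : `|y| <= modulus h by exact: (Im_modulus h).
have {}h1 := h1 x (le_lt_trans xh hr1).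
have {}h2 := h2 y (le_lt_trans yh hr2).
have {}h3 := h3 y (le_lt_trans yh hr3).
rewrite expR0 mulr1 in h1; rewrite sin0 oppr0 mulr0 subr0 in h2.
rewrite cos0 mulr1 subr0 in h3.
pose E : C := ((cos y +i* sin y)%C : C).
have -> : cexp h - 1 - h = (expR x - 1 - x)%:C%C * E
    + (1 + x)%:C%C * ((cos y - 1)%:C%C + 'i%C * (sin y - y)%:C%C) + 'i%C * (x * y)%:C%C.
  apply/eqP; rewrite eq_complex /=; apply/andP; split; apply/eqP; ring.
rewrite (le_trans (modulusD _ _)) // (le_trans (lerD (modulusD _ _) (lexx _))) //.
rewrite !modulusM modulus_cis modulus_i !modulus_real mul1r mulr1.
have t : modulus ((cos y - 1)%:C%C + 'i%C * (sin y - y)%:C%C : C) <= d * `|y| + d * `|y|.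
  by rewrite (le_trans (modulusD _ _)) // modulusM modulus_i mul1r !modulus_real lerD.
have x1 : `|1 + x| <= 2.
  by rewrite (le_trans (ler_normD _ _)) // normr1; have := le_trans xh (ltW hrd); lra.
have := ler_pM (normr_ge0 _) (modulus_ge0 _) x1 t.
have xy : `|x * y| <= d * `|y|.
  by rewrite normrM ler_wpM2r // (le_trans xh) // ltW.
have dx : d * `|x| <= d * modulus h by rewrite ler_wpM2l // ltW.
have dy : d * `|y| <= d * modulus h by rewrite ler_wpM2l // ltW.
have deh : d * modulus h <= e / 6 * modulus h by rewrite ler_wpM2r // modulus_ge0.
have := h1; have := xy; lra.
Qed.

Lemma is_derive_cexp z : is_derive z (1 : C) (@cexp R) (cexp z).
Proof.
apply/is_derive_epsP => e /posc_real[r r0 ->].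
have M1 : 0 < modulus (cexp z) + 1 by rewrite ltr_wpDl ?modulus_ge0.
have := cexp_near0 (divr_gt0 r0 M1); apply: filterS => h hh.
rewrite cexpD (norm_modulus h) -(rmorphM (real_complex R)) norm_le_real.
have -> : cexp h * cexp z - cexp z - h *: cexp z = cexp z * (cexp h - 1 - h).
  by rewrite !mulrBr mulr1 [cexp z * h]mulrC [cexp z * _]mulrC.
rewrite modulusM.
apply: le_trans (ler_wpM2l (modulus_ge0 _) hh) _.
rewrite mulrA ler_wpM2r ?modulus_ge0 // mulrC mulrAC ler_pdivrMr //.
by rewrite ler_pM2l // lerDl.
Qed.

(** The exponential has no zero: [cexp 0 = 1] is a multiple of each of its values. *)
Lemma log_branch_neq0 U (L : C -> C) z : log_branch U L -> U z -> z != 0.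
Proof.
move=> [_ _ eL] /eL <-; apply: contra_eq_neq (cexp0) => Lz0.
by rewrite -(subrr (L z)) cexpD Lz0 mul0r eq_sym oner_neq0.
Qed.

(** Inverse function argument: continuity makes k = L(z + h) - L(z) tend to 0, and the derivative of
    [cexp] at [L z] then gives h - k z = o(k). *)
Lemma log_branch_derive U (L : C -> C) z : log_branch U L -> U z ->
  is_derive z (1 : C) L z^-1.
Proof.
move=> LU Uz; have z0 := log_branch_neq0 LU Uz; case: LU => Uo Lc eL.
have m0 : 0 < modulus z by rewrite lt_neqAle modulus_ge0 andbT eq_sym modulus_eq0.
apply/is_derive_epsP => e /posc_real[r r0 ->].
(* The first bound absorbs the error s |k| and yields |k| |z| <= 2 |h|; the second turns the error s
   |k| / |z| into at most r |h|. *)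
pose s := Num.min (modulus z / 2) (r * modulus z ^+ 2 / 2).
have s0 : 0 < s by rewrite lt_min !(mulr_gt0, divr_gt0, exprn_gt0).
have := is_derive_cexp (L z); move=> /is_derive_epsP/(_ s%:C%C).
rewrite (ltcR 0) => /(_ s0) dE.
have Uh : \forall h \near (0 : C), U (h + z).
  have /nbhs_ballP[q q0 hq] : nbhs z U by apply: open_nbhs_nbhs; split.
  have : \forall h \near (0 : C), `|h| < q by apply: (@nbhs0_lt C C).
  by apply: filterS => h hh; apply: hq; rewrite /ball /= opprD addrCA subrr addr0 normrN.
have kE : (fun h => L (h + z) - L z) @ (0 : C) --> (0 : C).
  suff Lh : (fun h => L (h + z)) @ (0 : C) --> L z.
    by have := cvgB Lh (cvg_cst (L z)); rewrite subrr; apply.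
  have hz : (fun h : C => h + z) @ (0 : C) --> z.
    by have := cvgD (@cvg_id _ (nbhs (0 : C))) (cvg_cst z); rewrite add0r; apply.
  exact: (cvg_comp _ _ hz (Lc z Uz)).
have : \forall h \near (0 : C), `|cexp (L (h + z) - L z + L z) - cexp (L z) -
    (L (h + z) - L z) *: cexp (L z)| <= s%:C%C * `|L (h + z) - L z| by exact: (kE _ dE).
apply: filterS2 Uh => h Uh.
rewrite subrK (eL _ Uh) (eL _ Uz) addrK.
set k := L (h + z) - L z.
rewrite -[k *: z]/(k * z) -[h *: _]/(h * z^-1) (norm_modulus k) (norm_modulus h).
rewrite -!(rmorphM (real_complex R)) !norm_le_real => hk.
have sz : s <= modulus z / 2 by rewrite ge_min lexx.
have sr : s <= r * modulus z ^+ 2 / 2 by rewrite ge_min lexx orbT.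
have k2 : modulus k * modulus z <= 2 * modulus h.
  have : modulus (k * z) <= modulus h + modulus (h - k * z).
    by rewrite -[k * z in leLHS](subKr h) modulusB.
  rewrite modulusM => kz.
  have := ler_wpM2r (modulus_ge0 k) sz; lra.
have -> : k - h * z^-1 = - ((h - k * z) / z).
  by rewrite mulrBl mulfK // opprB.
rewrite modulusN modulusM modulusV ler_pdivrMr // (le_trans hk) //.
rewrite (le_trans (ler_wpM2r (modulus_ge0 k) sr)) //.
have := ler_wpM2l (ltW (mulr_gt0 r0 m0)) k2.
rewrite expr2; nra.
Qed.

End ComplexExponential.

(** * Functional equation of Gamma and growth of its ratios *)

Section GammaRatios.
Variable R : realType.
Local Notation C := (Cplx R).
Implicit Types z p q : C.

Lemma cvg_divn z : (fun n : nat => z / n%:R) @ \oo --> (0 : C).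
Proof.
apply/cvg_modulusP => e e0; exists (Num.truncn (modulus z / e)).+1 => // n /= hn.
have n0 : 0 < n%:R :> R by rewrite ltr0n (leq_ltn_trans _ hn).
rewrite sub0r modulusN modulusM modulusV modulus_nat ltr_pdivrMr // mulrC.
rewrite -ltr_pdivrMr // (lt_le_trans (truncnS_gt _)) // ler_nat //.
Qed.

(* No convergence is needed: if the limit defining Gamma z does not exist, then
   neither does the one defining Gamma (z + 1), and both are 0. *)
Lemma Gamma_succ z : (forall k : nat, z + k%:R != 0) ->
  Gamma (z + 1) = z * Gamma z.
Proof.
move=> zk; have z0 : z != 0 by have := zk 0%N; rewrite addr0.
rewrite /Gamma.
set s' := (X in limn X = _); set s := (X in _ = z * limn X).
(* For n > 0 this is (z + n + 1) / n, the factor by which the Gauss approximations of Gamma (z + 1)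
   and z Gamma z differ. *)
pose t (n : nat) := 1 + (z + 1) / n%:R.
have t1 : t @ \oo --> (1 : C).
  by have := cvgD (cvg_cst (1 : C)) (cvg_divn (z + 1)); rewrite addr0; apply.
have s'E n : (0 < n)%N -> s' n * t n = z * s n.
  move=> n0; rewrite /s' /s /t mulrDl mul1r cexpD cexp_real lnK ?posrE ?ltr0n //.
  rewrite (rmorph_nat (real_complex R)).
  have pE : z * \prod_(k < n.+1) (z + 1 + k%:R) =
      \prod_(k < n.+1) (z + k%:R) * (z + n.+1%:R).
    transitivity (\prod_(k < n.+2) (z + k%:R)); last by rewrite big_ord_recr.
    rewrite [RHS]big_ord_recl addr0; congr (_ * _).
    by apply: eq_bigr => k _; rewrite -addrA nat1r.
  have -> : 1 + (z + 1) / n%:R = (z + n.+1%:R) / n%:R.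
    by rewrite -natr1; field; rewrite pnatr_eq0 -lt0n.
  have p0 : \prod_(k < n.+1) (z + k%:R) != 0 by apply/prodf_neq0 => k _.
  have p1 : \prod_(k < n.+1) (z + 1 + k%:R) != 0.
    by apply/prodf_neq0 => k _; rewrite -addrA nat1r.
  have n0' : n%:R != 0 :> C by rewrite pnatr_eq0 -lt0n.
  move: pE p0 p1; set P' := \prod_k _; set P := \prod_k _ => pE p0 p1.
  have -> : z + n.+1%:R = z * P' / P by rewrite pE mulrC mulKf.
  by field; rewrite n0' p0 p1.
have t0 n : t n.+1 != 0.
  have : t n.+1 * n.+1%:R != 0.
    rewrite /t mulrDl mul1r divfK ?pnatr_eq0 //.
    by rewrite (_ : n.+1%:R + (z + 1) = z + n.+2%:R) // -[n.+2%:R]natr1; ring.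
  by apply: contra_neq => ->; rewrite mul0r.
have sE : cvgn s' -> s @ \oo --> z^-1 * limn s'.
  move=> cs'; rewrite -[limn s']mulr1.
  apply: (cvg_trans _ (cvgM (cvg_cst z^-1) (cvgM cs' t1))).
  apply: near_eq_cvg; exists 1%N => // n /= n0.
  by rewrite /= s'E // mulKf.
have s'l : cvgn s -> s' @ \oo --> z * limn s.
  move=> cs; rewrite -[z * limn s]mulr1 -invr1.
  apply: (cvg_trans _ (cvgM (cvgM (cvg_cst z) cs) (cvgV (oner_neq0 _) t1))).
  apply: near_eq_cvg; exists 1%N => // -[//|n] _.
  by rewrite /= -s'E // mulfK.
have [cs|ncs] := pselect (cvgn s); first exact: (cvg_lim (@norm_hausdorff _ _) (s'l cs)).
have ncs' : ~ cvgn s' by move=> /sE cs; apply: ncs; apply/cvg_ex; exists (z^-1 * limn s').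
by rewrite (dvgP ncs) (dvgP ncs') [LHS]/point [X in _ * X]/point /= mulr0.
Qed.

Lemma not_int_addn z (n : nat) : not_int z -> z + n%:R != 0.
Proof.
move=> /(_ (- n%:Z)); apply: contra_neq => /eqP; rewrite addr_eq0 => /eqP ->.
by rewrite mulrNz.
Qed.

(** The ratio of consecutive terms tends to 1, so after multiplication by r^n with r < 1 the moduli
    eventually decrease. *)
Lemma subgeometric_ratio (a : nat -> C) p q :
  (forall n, a n.+1 = (p + n%:R) / (q + n%:R + 1) * a n) -> subgeometric a.
Proof.
move=> aS r /andP[r0 r1].
pose P := modulus p; pose Q := modulus (q + 1).
have P0 : 0 <= P by exact: modulus_ge0.
have Q0 : 0 <= Q by exact: modulus_ge0.
(* Beyond [x] one has (P + n) r <= n - Q; the extra [Q] also gives n > Q, so that the denominator q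
   + n + 1 is nonzero. *)
pose x := (P * r + Q) / (1 - r) + Q.
pose N := (Num.truncn x).+1; pose f n := modulus (a n) * r ^+ n.
have f0 n : 0 <= f n by rewrite mulr_ge0 ?modulus_ge0 // exprn_ge0 // ltW.
have fS n : (N <= n)%N -> f n.+1 <= f n.
  move=> Nn; have xn : x < n%:R by rewrite (lt_le_trans (truncnS_gt _)) // ler_nat.
  have r1' : 0 < 1 - r by rewrite subr_gt0.
  have PQ0 : 0 <= P * r + Q by rewrite addr_ge0 // mulr_ge0 // ltW.
  have y0 := divr_ge0 PQ0 (ltW r1').
  have Qn : Q < n%:R by move: xn; rewrite /x; lra.
  have h1 : P * r + Q <= n%:R * (1 - r) by rewrite -ler_pdivrMr //; move: xn; rewrite /x; lra.
  have lo : n%:R - Q <= modulus (q + n%:R + 1).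
    rewrite addrAC lerBlDr -[n%:R in leLHS]modulus_nat -[n%:R in leLHS](addrK (q + 1)).
    by rewrite addrC [n%:R + _]addrC addrC modulusB.
  have hi : modulus (p + n%:R) <= P + n%:R by rewrite -[n%:R in leRHS]modulus_nat modulusD.
  have d0 : 0 < modulus (q + n%:R + 1) by rewrite (lt_le_trans _ lo) // subr_gt0.
  rewrite /f aS !modulusM modulusV exprS mulrACA mulrA ler_wpM2r ?exprn_ge0 ?(ltW r0) //.
  rewrite ler_piMl ?modulus_ge0 // mulrAC ler_pdivrMr // mul1r.
  apply: le_trans lo; apply: (@le_trans _ _ ((P + n%:R) * r)).
    by rewrite ler_wpM2r // ltW.
  lra.
(* A sum of nonnegative terms serves as an upper bound for the initial ones. *)
exists (\sum_(k < N.+1) f k) => n.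
have small k : (k <= N)%N -> f k <= \sum_(k < N.+1) f k.
  move=> kN; rewrite (bigD1 (Ordinal (kN : (k < N.+1)%N))) //= lerDl sumr_ge0 //.
have [/small //|/ltnW Nn] := leqP n N.
rewrite -/(f n) -(subnK Nn); elim: (n - N)%N => [|k IHk]; first exact: small.
by rewrite addSn (le_trans (fS _ _)) // leq_addl.
Qed.

Lemma subgeometric_prod (I : Type) (s : seq I) (a : I -> nat -> C) :
  (forall i, subgeometric (a i)) ->
  subgeometric (fun n => \prod_(i <- s) a i n).
Proof.
move=> ha; elim: s => [|i s IHs].
  by under eq_fun do rewrite big_nil; exact: (@subgeometric_cst _ 1).
by under eq_fun do rewrite big_cons; exact: subgeometricM.
Qed.

Variables (m : nat) (b c : 'I_m -> C).
Hypothesis bb : forall i j, i != j -> not_int (b i - b j).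
Hypothesis bc : forall i j, not_int (b i - c j).

(** Includes i = k, where the positive shift, not non-resonance, keeps the factor away from 0. *)
Let bb0 i k (n : nat) : b i - b k + n.+1%:R != 0.
Proof.
have [->|ik] := eqVneq i k; first by rewrite subrr add0r pnatr_eq0.
exact: not_int_addn (bb ik).
Qed.

Let ratio i k (n : nat) : C :=
  (Gamma (b i - c k + n%:R) * Gamma (b i - b k + 1)) /
                 (Gamma (b i - c k) * Gamma (b i - b k + n%:R + 1)).

Let ratioS i k n : ratio i k n.+1 =
  (b i - c k + n%:R) / (b i - b k + n%:R + 1) * ratio i k n.
Proof.
rewrite /ratio -natr1 !addrA (@Gamma_succ (b i - c k + n%:R)); last first.
  by move=> j; rewrite -addrA -natrD not_int_addn.
rewrite (@Gamma_succ (b i - b k + n%:R + 1)); last first.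
  move=> j; rewrite (_ : b i - b k + n%:R + 1 + j%:R = b i - b k + (n + j).+1%:R) //.
  by rewrite -natr1 natrD; ring.
by rewrite !invfM; ring.
Qed.

Lemma subgeometric_alpha i : subgeometric (alpha b c i).
Proof.
apply: (@subgeometric_prod _ _ (ratio i)) => k.
exact: (subgeometric_ratio (ratioS i k)).
Qed.

(** The linear factors produced by Gamma assemble over k into Q at b_i + n and P at b_i + n + 1, the
    scalars of the two pencil identities. *)
Lemma alphaS i n : alpha b c i n.+1 =
  (nodal c).[b i + n%:R] / (nodal b).[b i + n.+1%:R] * alpha b c i n.
Proof.
rewrite !horner_nodal -prodf_div -big_split; apply: eq_bigr => k _ /=.
rewrite [LHS](ratioS i k n); congr (_ / _ * _); first by rewrite addrAC.
by rewrite -[n.+1%:R]natr1; ring.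
Qed.

Lemma nodal_shift_neq0 i n : (nodal b).[b i + n.+1%:R] != 0.
Proof. by rewrite horner_nodal; apply/prodf_neq0 => k _; rewrite addrAC. Qed.

End GammaRatios.

Lemma pser_euler (R : realType) (a : nat -> Cplx R) z :
  subgeometric a -> modulus z < 1 ->
  pser (fun n => n%:R * a n) z = z * pser (fun n => n.+1%:R * a n.+1) z.
Proof.
move=> ha z1; have hna : subgeometric (fun n => n%:R * a n).
  by apply: subgeometricM => //; exact: subgeometric_nat.
rewrite -(pser_shift (subgeometricS hna) z1); congr (pser _ z).
by apply/funext => -[|n] //; exact: mul0r.
Qed.

(** * Vector power series and comparison of coefficients *)

Section VectorPowerSeries.
Variables (R : realType) (m : nat).
Local Notation K := (Cplx R).
Implicit Types f : nat -> 'cV[K]_m.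

Let colZ (a : K) (x : 'cV[K]_m) p : (a *: x) p 0 = a * x p 0.
Proof. exact: mxE. Qed.

Let colD (x y : 'cV[K]_m) p : (x + y) p 0 = x p 0 + y p 0.
Proof. exact: mxE. Qed.

Let colN (x : 'cV[K]_m) p : (- x) p 0 = - x p 0.
Proof. exact: mxE. Qed.

Definition vsubgeometric f := forall p, subgeometric (fun n => f n p 0).

Definition vser f (z : K) : 'cV[K]_m := \col_p pser (fun n => f n p 0) z.

Lemma vserE f z p : vser f z p 0 = pser (fun n => f n p 0) z.
Proof. by rewrite mxE. Qed.

Definition dvser f := vser (fun n => n.+1%:R *: f n.+1).

Lemma dvserE f z p : dvser f z p 0 = pser (fun n => n.+1%:R * f n.+1 p 0) z.
Proof.
by rewrite [LHS]vserE; congr (pser _ z); apply/funext => n; rewrite mxE.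
Qed.

Lemma vser_derive f z p : vsubgeometric f -> modulus z < 1 ->
  is_derive z (1 : K) (fun y => vser f y p 0) (dvser f z p 0).
Proof.
move=> sf z1.
have -> : (fun y => vser f y p 0) = pser (fun n => f n p 0).
  by apply/funext => y; exact: vserE.
by rewrite dvserE; exact: pser_derive.
Qed.

Lemma subgeometric_mulmx (M : 'M[K]_m) f p : vsubgeometric f ->
  subgeometric (fun n => (M *m f n) p 0).
Proof.
move=> sf; under eq_fun do rewrite mxE; apply: subgeometric_sum => q.
by apply: subgeometricM; [exact: subgeometric_cst|exact: sf].
Qed.

Lemma mulmx_vser (M : 'M[K]_m) f z : vsubgeometric f -> modulus z < 1 ->
  M *m vser f z = vser (fun n => M *m f n) z.
Proof.
move=> sf z1; apply/colP => p; rewrite vserE mxE; under [in RHS]eq_fun do rewrite mxE.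
rewrite pser_sum //; last first.
  by move=> q; apply: subgeometricM; [exact: subgeometric_cst|exact: sf].
by apply: eq_bigr => q _; rewrite vserE (pserZ _ (sf q) z1).
Qed.

(** With D = z d/dz the equation is (1 - z)(s + D) F = B F + z C F: its constant term is the
    eigenvector condition on [f 0], its coefficient of z^(n+1) the recurrence. *)
Lemma frobenius_recurrence_ode (B C : 'M[K]_m) (s : K) f z :
  vsubgeometric f -> modulus z < 1 -> B *m f 0%N = s *: f 0%N ->
  (forall n, (s + n.+1%:R) *: f n.+1 - B *m f n.+1 =
             (s + n%:R) *: f n + C *m f n) ->
  (1 - z) *: (s *: vser f z + z *: dvser f z) =
  B *m vser f z + z *: (C *m vser f z).
Proof.
move=> sf z1 f0 fS; rewrite !mulmx_vser //; apply/colP => p.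
have sp := sf p.
have snf : subgeometric (fun n => n%:R * f n p 0).
  by apply: subgeometricM => //; exact: subgeometric_nat.
have sbf : subgeometric (fun n => s * f n p 0).
  by apply: subgeometricM => //; exact: subgeometric_cst.
pose g n := s * f n p 0 + n%:R * f n p 0.
have sg : subgeometric g by exact: subgeometricD.
have gE : pser g z = (s *: vser f z + z *: dvser f z) p 0.
  by rewrite pserD // pserZ // pser_euler // colD !colZ (vserE f) (dvserE f).
rewrite colZ -gE colD colZ (vserE (fun n => B *m f n)) (vserE (fun n => C *m f n)).
have sB := @subgeometric_mulmx B f p sf.
have sC := @subgeometric_mulmx C f p sf.
rewrite mulrBl mul1r -!pser_shift // -mulN1r -pserZ //; last exact: subgeometric_shift.
rewrite -!pserD //; first last.
- exact: subgeometric_shift.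
- by apply: subgeometricM; [exact: subgeometric_cst|exact: subgeometric_shift].
congr (pser _ z); apply/funext => -[|n].
  by rewrite mulr0 !addr0 f0 /g mul0r addr0 colZ.
have := congr1 (fun y : 'cV_m => y p 0) (fS n).
rewrite !(colD, colN, colZ).
rewrite /g => e; rewrite mulN1r -!mulrDl; apply/eqP.
rewrite subr_eq -addrA [X in _ == _ + X]addrC -e.
by rewrite addrCA subrr addr0.
Qed.

End VectorPowerSeries.

(** Both members are the same multiple s p = t q of [u], although [g] and [h] belong to different
    points. *)
Lemma pencil_step (F : fieldType) m (M N : 'M[F]_m) (g h u : 'cV[F]_m)
    (x y p q s t : F) :
  (x%:M - M) *m g = p *: u -> (y%:M + N) *m h = q *: u -> s * p = t * q ->
  x *: (s *: g) - M *m (s *: g) = y *: (t *: h) + N *m (t *: h).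
Proof.
move=> eg eh st; transitivity (s *: ((x%:M - M) *m g)).
  by rewrite mulmxBl mul_scalar_mx scalerBr -scalemxAr !scalerA mulrC.
rewrite eg scalerA st -scalerA -eh mulmxDl mul_scalar_mx scalerDr -scalemxAr.
by rewrite !scalerA mulrC.
Qed.

(** * The series at 0: recurrence, convergence, differential equation *)

Section FrobeniusSeries.
Variables (R : realType) (m : nat).
Local Notation K := (Cplx R).
Variables (B C : 'M[K]_m) (b c : 'I_m -> K).
Variables (v w : 'I_m -> 'cV[K]_m) (u : 'cV[K]_m).
Hypotheses (bb : forall i j, i != j -> not_int (b i - b j)).
Hypotheses (cc : forall i j, i != j -> not_int (c i - c j)).
Hypotheses (bc : forall i j, not_int (b i - c j)).
Hypothesis ev : forall i, v i != 0 /\ B *m v i = b i *: v i.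
Hypothesis ew : forall i, w i != 0 /\ C *m w i = - c i *: w i.
Hypotheses (sv : \sum_i v i = u) (sw : \sum_i w i = u).
Hypothesis rk1 : forall y : 'cV_m, exists s, (B + C) *m y = s *: u.

Lemma not_int_injective (d : 'I_m -> K) :
  (forall i j, i != j -> not_int (d i - d j)) -> injective d.
Proof.
move=> dd i j dij; apply/eqP; apply: contraTT isT => ij.
by have := dd i j ij 0; rewrite dij subrr eqxx.
Qed.

Let bI := not_int_injective bb.
Let cI := not_int_injective cc.
Let vU : cols v \in unitmx. Proof. exact: eigen_cols_unit bI ev. Qed.

Variable i : 'I_m.

Definition frobenius_coef (n : nat) : 'cV[K]_m :=
  alpha b c i n *: (mxexp (n%:R *: Smx b v) *m v i).

Lemma frobenius_coefE n : frobenius_coef n =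
  (alpha b c i n / (conodal b i).[b i]) *: (cols v *m conodal_col b (b i + n%:R)).
Proof.
have q0 := conodal_neq0 i bI.
rewrite /frobenius_coef -scalerA; congr (_ *: _); apply: (scalerI q0).
by rewrite scalerA mulfV // scale1r -mxexp_Smx_conodal // cols_conodal_node scalemxAr.
Qed.

Lemma frobenius_coef0 : B *m frobenius_coef 0 = b i *: frobenius_coef 0.
Proof.
rewrite frobenius_coefE addr0 cols_conodal_node.
by rewrite -!scalemxAr (ev i).2 !scalerA; congr (_ *: _); ring.
Qed.

Lemma frobenius_coefS n :
  (b i + n.+1%:R) *: frobenius_coef n.+1 - B *m frobenius_coef n.+1 =
  (b i + n%:R) *: frobenius_coef n + C *m frobenius_coef n.
Proof.
have e1 := sub_eigen_conodal (b i + n.+1%:R) (fun j => (ev j).2).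
have e2 := add_eigen_conodal cI ev ew sv sw rk1 (b i + n%:R).
rewrite sv in e1; rewrite (frobenius_coefE n.+1) (frobenius_coefE n).
(* The required balance is P(b_i + n + 1) alpha_(n+1) = Q(b_i + n) alpha_n. *)
apply: (pencil_step e1 e2); rewrite alphaS //; field.
by rewrite conodal_neq0 // nodal_shift_neq0.
Qed.

(** By nilpotency the entries of exp(nS) are polynomials in n and do not shrink the disc of
    convergence. *)
Lemma subgeometric_mxexp p q :
  subgeometric (fun n => alpha b c i n * mxexp (n%:R *: Smx b v) p q).
Proof.
apply: subgeometricM; first exact: subgeometric_alpha.
under eq_fun do rewrite (mxexp_nilpotent _ (Smx_nilpotent bI vU)) summxE.
apply: subgeometric_sum => k; under eq_fun do rewrite mxE.
apply: subgeometricM; last exact: subgeometric_cst.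
apply: subgeometricM; first exact: subgeometric_cst.
by apply: subgeometricX; exact: subgeometric_nat.
Qed.

Lemma frobenius_coef_entry p n : frobenius_coef n p 0 =
  \sum_q v i q 0 * (alpha b c i n * mxexp (n%:R *: Smx b v) p q).
Proof.
rewrite !mxE mulr_sumr; apply: eq_bigr => q _; ring.
Qed.

Lemma vsubgeometric_frobenius : vsubgeometric frobenius_coef.
Proof.
move=> p; under eq_fun do rewrite frobenius_coef_entry.
apply: subgeometric_sum => q; apply: subgeometricM; last exact: subgeometric_mxexp.
exact: subgeometric_cst.
Qed.

Lemma T0_series_cvg z : modulus z < 1 ->
  T0_series b c (Smx b v) i z @ \oo -->
  (\matrix_(p, q) pser (fun n => alpha b c i n * mxexp (n%:R *: Smx b v) p q) z : 'M[K]_m).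
Proof.
move=> z1; apply: cvg_mx_entries => p q; rewrite mxE.
have -> : (fun N => T0_series b c (Smx b v) i z N p q) =
    series (fun n => alpha b c i n * mxexp (n%:R *: Smx b v) p q * z ^+ n).
  apply/funext => N; rewrite /T0_series /series /= summxE; apply: eq_bigr => n _.
  by rewrite mxE mulrAC.
exact: pser_cvg (@subgeometric_mxexp p q) z1.
Qed.

Lemma T0_series_sum z : modulus z < 1 ->
  limn (T0_series b c (Smx b v) i z) *m v i = vser frobenius_coef z.
Proof.
move=> z1; rewrite (cvg_lim (@norm_hausdorff _ _) (T0_series_cvg z1)).
apply/colP => p; rewrite vserE; under [in RHS]eq_fun do rewrite frobenius_coef_entry.
rewrite pser_sum //; last first.
  by move=> q; apply: subgeometricM; [exact: subgeometric_cst|exact: subgeometric_mxexp].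
rewrite mxE; apply: eq_bigr => q _.
rewrite (pserZ _ (@subgeometric_mxexp p q) z1) mulrC; congr (_ * _); exact: mxE.
Qed.

Lemma frobenius_ode z : modulus z < 1 ->
  (1 - z) *: (b i *: vser frobenius_coef z +
              z *: dvser frobenius_coef z) =
  B *m vser frobenius_coef z + z *: (C *m vser frobenius_coef z).
Proof.
move=> z1; apply: frobenius_recurrence_ode => //.
- exact: vsubgeometric_frobenius.
- exact: frobenius_coef0.
- exact: frobenius_coefS.
Qed.

End FrobeniusSeries.

(** Partial fractions: (B + z C) / (z (1 - z)) = B / z - (B + C) / (z - 1). The right member is laid
    out as the derivative of a power times a series; the factor 1 is the derivative of the local
    parameter [z]. *)
Lemma fuchsian_field_at0 (F : fieldType) m (B C : 'M[F]_m) (f g : 'cV[F]_m)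
    (s e z : F) : z != 0 -> 1 - z != 0 ->
  (1 - z) *: (s *: f + z *: g) = B *m f + z *: (C *m f) ->
  ((z - 1)^-1 *: (- (B + C)) + z^-1 *: B) *m (e *: f) =
  (e * 1) *: g + (e * (s * z^-1)) *: f.
Proof.
move=> z0 z1 ode; rewrite mulr1 -(scalerA e _ f) -scalerDr.
rewrite -scalemxAr; congr (_ *: _).
rewrite mulmxDl -!scalemxAl mulNmx mulmxDl.
apply/colP => p; have := congr1 (fun y : 'cV_m => y p 0) ode.
rewrite ![(_ + _ : 'cV_m) p 0]mxE ![(_ *: _ : 'cV_m) p 0]mxE.
rewrite ![(_ + _ : 'cV_m) p 0]mxE ![(_ *: _ : 'cV_m) p 0]mxE.
rewrite ![(- _ : 'cV_m) p 0]mxE ![(_ + _ : 'cV_m) p 0]mxE => h.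
have z1' : z - 1 != 0 by rewrite -opprB oppr_eq0.
have -> : g p 0 + s * z^-1 * f p 0 = (1 - z) * (s * f p 0 + z * g p 0) / (z * (1 - z)).
  by field; rewrite z0 z1.
by rewrite h; field; rewrite z0 z1.
Qed.

(** In the parameter 1/z the exponent is [- s], and [- z ^- 2] is the derivative of that
    parameter. *)
Lemma fuchsian_field_at_infty (F : fieldType) m (B C : 'M[F]_m) (f g : 'cV[F]_m)
    (s e z : F) : z != 0 -> z - 1 != 0 ->
  (1 - z^-1) *: (- s *: f + z^-1 *: g) = C *m f + z^-1 *: (B *m f) ->
  ((z - 1)^-1 *: (- (B + C)) + z^-1 *: B) *m (e *: f) =
  (e * (- z ^- 2)) *: g + (e * (s * z^-1)) *: f.
Proof.
move=> z0 z1 ode; rewrite -(scalerA e _ g) -(scalerA e _ f) -scalerDr.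
rewrite -scalemxAr; congr (_ *: _).
rewrite mulmxDl -!scalemxAl mulNmx mulmxDl.
apply/colP => p; have := congr1 (fun y : 'cV_m => y p 0) ode.
rewrite ![(_ + _ : 'cV_m) p 0]mxE ![(_ *: _ : 'cV_m) p 0]mxE.
rewrite ![(_ + _ : 'cV_m) p 0]mxE ![(_ *: _ : 'cV_m) p 0]mxE.
rewrite ![(- _ : 'cV_m) p 0]mxE ![(_ + _ : 'cV_m) p 0]mxE => h.
have -> : - z ^- 2 * g p 0 + s * z^-1 * f p 0 =
    - ((1 - z^-1) * (- s * f p 0 + z^-1 * g p 0)) / (z - 1).
  by field; rewrite z0 z1.
by rewrite h; field; rewrite z0 z1.
Qed.

(** * Solutions of the Fuchsian system at 0 and at infinity *)

Section FuchsianSolutions.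
Variables (R : realType) (m : nat).
Local Notation K := (Cplx R).

Lemma is_derive_cexpZ (s : K) (L : K -> K) z d : is_derive z (1 : K) L d ->
  is_derive z (1 : K) (fun y => cexp (s * L y)) (cexp (s * L z) * (s * d)).
Proof.
move=> Ld; exact: (@is_derive_scomp _ (@cexp R) (fun y => s * L y) z _ _
  (is_derive_cexp (s * L z)) (is_deriveZ s Ld)).
Qed.

(** Shared by both points: [g] is the local parameter, [z] or its inverse. *)
Lemma is_derive_cexp_vser (s : K) (L g : K -> K) (f : nat -> 'cV[K]_m) z dg :
  is_derive z (1 : K) L z^-1 -> is_derive z (1 : K) g dg ->
  vsubgeometric f -> modulus (g z) < 1 ->
  is_derive z (1 : K) (fun y => cexp (s * L y) *: vser f (g y))
    ((cexp (s * L z) * dg) *: dvser f (g z) +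
     (cexp (s * L z) * (s * z^-1)) *: vser f (g z)).
Proof.
move=> Ld gd sf z1.
exact: (is_derive_scale_comp (is_derive_cexpZ s Ld) gd (fun p => vser_derive p sf z1)).
Qed.

Section AtZero.
Variables (B C : 'M[K]_m) (b c : 'I_m -> K).
Variables (v w : 'I_m -> 'cV[K]_m) (u : 'cV[K]_m).
Hypotheses (bb : forall i j, i != j -> not_int (b i - b j)).
Hypotheses (cc : forall i j, i != j -> not_int (c i - c j)).
Hypotheses (bc : forall i j, not_int (b i - c j)).
Hypothesis ev : forall i, v i != 0 /\ B *m v i = b i *: v i.
Hypothesis ew : forall i, w i != 0 /\ C *m w i = - c i *: w i.
Hypotheses (sv : \sum_i v i = u) (sw : \sum_i w i = u).
Hypothesis rk1 : forall y : 'cV_m, exists s, (B + C) *m y = s *: u.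

Lemma T0_series_is_cvg i z : modulus z < 1 ->
  cvgn (T0_series b c (Smx b v) i z).
Proof. by move=> z1; apply/cvg_ex; eexists; exact: (T0_series_cvg bb bc ev). Qed.

Lemma T0_solution i U L : log_branch U L ->
  U `<=` [set z : K | 0 < `|z| < 1] ->
  fuchsian_solution (- (B + C)) B U (T0 b c (Smx b v) v L i).
Proof.
move=> LU U1 z Uz.
have Ld := log_branch_derive LU Uz.
have z0 := log_branch_neq0 LU Uz.
have z1 : modulus z < 1 by have /andP[_] := U1 z Uz; rewrite norm_lt1.
pose f := frobenius_coef b c v i.
have [Uo _ _] := LU.
(* The rewriting as a vector series is available on [U] only; as [U] is open, this is enough for a
   derivative at [z]. *)
have Tnear : {near z, (fun y => cexp (b i * L y) *: vser f y) =1 T0 b c (Smx b v) v L i}.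
  have : nbhs z U by apply: open_nbhs_nbhs; split.
  apply: filterS => y Uy; rewrite /T0 (T0_series_sum bb bc ev) //.
  by have /andP[_] := U1 y Uy; rewrite norm_lt1.
apply: (near_eq_is_derive Tnear).
have z1' : 1 - z != 0.
  by apply: contraTneq z1 => /subr0_eq <-; rewrite modulus1 ltxx.
have TE : T0 b c (Smx b v) v L i z = cexp (b i * L z) *: vser f z.
  by rewrite /T0 (T0_series_sum bb bc ev).
rewrite TE (fuchsian_field_at0 _ z0 z1' (frobenius_ode bb cc bc ev ew sv sw rk1 i z1)).
exact: (is_derive_cexp_vser (b i) Ld (is_derive_id z 1)
  (vsubgeometric_frobenius bb bc ev i) z1).
Qed.

End AtZero.

Section AtInfinity.
Variables (B C : 'M[K]_m) (b c : 'I_m -> K).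
Variables (v w : 'I_m -> 'cV[K]_m) (u : 'cV[K]_m).
Hypotheses (bb : forall i j, i != j -> not_int (b i - b j)).
Hypotheses (cc : forall i j, i != j -> not_int (c i - c j)).
Hypotheses (bc : forall i j, not_int (b i - c j)).
Hypothesis ev : forall i, v i != 0 /\ B *m v i = b i *: v i.
Hypothesis ew : forall i, w i != 0 /\ C *m w i = - c i *: w i.
Hypotheses (sv : \sum_i v i = u) (sw : \sum_i w i = u).
Hypothesis rk1 : forall y : 'cV_m, exists s, (B + C) *m y = s *: u.

(* The system at infinity is the system at 0 of the triple (A, C, B), whose
   eigenvalue data are -c and -(-b), in the variable 1/z. *)
Let b' i := - c i.
Let c' i := - b i.

Let bb' i j : i != j -> not_int (b' i - b' j).
Proof. by rewrite eq_sym => /cc; rewrite /b' opprK addrC. Qed.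

Let cc' i j : i != j -> not_int (c' i - c' j).
Proof. by rewrite eq_sym => /bb; rewrite /c' opprK addrC. Qed.

Let bc' i j : not_int (b' i - c' j).
Proof. by rewrite /b' /c' opprK addrC; exact: bc. Qed.

Let ev' i : v i != 0 /\ B *m v i = - c' i *: v i.
Proof. by rewrite /c' opprK; exact: ev. Qed.

Let rk1' y : exists s, (C + B) *m y = s *: u.
Proof. by rewrite addrC; exact: rk1. Qed.

(** Passing from [v] to [w] preserves S, negating the nodes changes its sign. *)
Let Smx_swap : Smx b' w = - Smx b v.
Proof.
rewrite Smx_opp; congr (- _).
exact: (Smx_sym (not_int_injective bb) (not_int_injective cc) ev ew sv sw rk1).
Qed.

Let alpha_swap i n : alpha b' c' i n = beta b c i n.
Proof.
apply: eq_bigr => k _; have e1 : b' i - c' k = b k - c i by rewrite /b' /c' opprK addrC.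
have e2 : b' i - b' k = c k - c i by rewrite /b' opprK addrC.
by rewrite e1 e2.
Qed.

Let Tinf_seriesE i z :
  Tinf_series b c (Smx b v) i z = T0_series b' c' (Smx b' w) i z^-1.
Proof.
have E n : (beta b c i n * z ^- n) *: mxexp (- (n%:R *: Smx b v)) =
    (alpha b' c' i n * z^-1 ^+ n) *: mxexp (n%:R *: Smx b' w).
  by rewrite alpha_swap exprVn Smx_swap scalerN.
exact: (congr1 series (funext E)).
Qed.

Let modulusV_lt1 (z : K) : 1 < modulus z -> modulus z^-1 < 1.
Proof. by move=> z1; rewrite modulusV invf_lt1 // (lt_trans ltr01). Qed.

Lemma Tinf_series_is_cvg i z : 1 < modulus z ->
  cvgn (Tinf_series b c (Smx b v) i z).
Proof.
by move=> z1; rewrite Tinf_seriesE; apply: T0_series_is_cvg bb' bc' ew _ _ (modulusV_lt1 z1).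
Qed.

Lemma Tinf_solution i U L : log_branch U L ->
  U `<=` [set z : K | 1 < `|z|] ->
  fuchsian_solution (- (B + C)) B U (Tinf b c (Smx b v) w L i).
Proof.
move=> LU U1 z Uz.
have Ld := log_branch_derive LU Uz.
have z0 := log_branch_neq0 LU Uz.
have z1 : 1 < modulus z by have := U1 z Uz; rewrite /= norm_gt1.
pose f := frobenius_coef b' c' w i.
have [Uo _ _] := LU.
have TE y : U y -> Tinf b c (Smx b v) w L i y = cexp (c i * L y) *: vser f y^-1.
  move=> Uy; rewrite /Tinf Tinf_seriesE (T0_series_sum bb' bc' ew) //.
  by apply: modulusV_lt1; have := U1 y Uy; rewrite /= norm_gt1.
have Tnear : {near z, (fun y => cexp (c i * L y) *: vser f y^-1) =1 Tinf b c (Smx b v) w L i}.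
  have : nbhs z U by apply: open_nbhs_nbhs; split.
  by apply: filterS => y Uy; rewrite TE.
apply: (near_eq_is_derive Tnear).
have z1' : z - 1 != 0.
  by apply: contraTneq z1 => /subr0_eq ->; rewrite modulus1 ltxx.
have ode := frobenius_ode bb' cc' bc' ew ev' sw sv rk1' i (modulusV_lt1 z1).
rewrite (TE z Uz) (fuchsian_field_at_infty _ z0 z1' ode).
exact: (is_derive_cexp_vser (c i) Ld (is_derive_inv z0)
  (vsubgeometric_frobenius bb' bc' ew i) (modulusV_lt1 z1)).
Qed.

End AtInfinity.
End FuchsianSolutions.

Theorem theorem1p4 (R : realType) (m : nat) (A B C : 'M[Cplx R]_m)
    (a1 a2 : Cplx R) (b c : 'I_m -> Cplx R)
    (u : 'cV[Cplx R]_m) (v w : 'I_m -> 'cV[Cplx R]_m) :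
  additive_hypergeometric_triple A B C a1 a2 b c u v w ->
  a2 = 0 ->
  let S := Smx b v in
  forall i : 'I_m,
    [/\ forall z : Cplx R, `|z| < 1 -> cvgn (T0_series b c S i z),
        forall (U : set (Cplx R)) (L : Cplx R -> Cplx R),
          log_branch U L ->
          U `<=` [set z : Cplx R | 0 < `|z| < 1] ->
          fuchsian_solution A B U (T0 b c S v L i),
        forall z : Cplx R, 1 < `|z| -> cvgn (Tinf_series b c S i z)
      & forall (U : set (Cplx R)) (L : Cplx R -> Cplx R),
          log_branch U L ->
          U `<=` [set z : Cplx R | 1 < `|z|] ->
          fuchsian_solution A B U (Tinf b c S w L i)].
Proof.
case=> _ sABC _ _ dA a12 cA [u0 Au] ev ew bb cc bc sv sw a20 S i.
have AE : A = - (B + C) by apply/eqP; rewrite -addr_eq0 addrA sABC.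
(* Here [a2 = 0] acts twice: it makes [a1] nonzero and leaves 0 as an eigenvalue of multiplicity m -
   1, so that A has rank one. *)
have a10 : a1 != 0 by rewrite -a20.
rewrite a20 subr0 in cA.
have rk1 y : exists s, (B + C) *m y = s *: u.
  have [s hs] := rank_one_image y dA a10 cA u0 Au.
  by exists (- s); rewrite scaleNr -hs AE mulNmx opprK.
split.
- by move=> z; rewrite norm_lt1; exact: T0_series_is_cvg bb bc ev i z.
- by move=> U L LU U1; rewrite AE; exact: (T0_solution bb cc bc ev ew sv sw rk1 i LU U1).
- by move=> z; rewrite norm_gt1 => z1; exact: (Tinf_series_is_cvg bb cc bc ev ew sv sw rk1 z1).
- by move=> U L LU U1; rewrite AE; exact: (Tinf_solution bb cc bc ev ew sv sw rk1 i LU U1).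
Qed.
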